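(* Let $|q|<1$ and $(a,b)$ a pair of coprime integers with $1\leq b<a$. If $a<2b$ then \[ \sum_{m\in\mathbb Z_{\ge0}^d}\frac{q^{\bar m^TCm}}{(q)_{2m_1}}\prod_{j=2}^d\begin{bmatrix}\tau_jm_j+n_j\\ \tau_jm_j\end{bmatrix}=\frac{(q^{ab-1},q^{ab},q^{2ab-1};q^{2ab-1})_\infty}{(q;q)_\infty}. \] If $a>2b$ and $b\ne1$ then \[ \sum_{\substack{n_1,\dots,n_{a_0}\ge0\\ m_{a_0+1},\dots,m_d\ge0}}\frac{q^{\sum_{i=1}^{a_0}(N_i+m_{a_0+1})^2+\sum_{j,k=a_0+1}^d\bar m_jC_{j,k}m_k}}{(q)_{n_1}\cdots(q)_{n_{a_0}}(q)_{2m_{a_0+1}}}\prod_{j=a_0+2}^d\begin{bmatrix}\tau_jm_j+n_j\\ \tau_jm_j\end{bmatrix}=\frac{(q^{ab-1},q^{ab},q^{2ab-1};q^{2ab-1})_\infty}{(q;q)_\infty}. \]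
   Context: Notation: $(x;q)_n=\prod_{i=0}^{n-1}(1-xq^i)$ (also $n=\infty$), $(q)_n=(q;q)_n$, $(x_1,\dots,x_r;q)_\infty=\prod_i(x_i;q)_\infty$; $\begin{bmatrix}n\\ m\end{bmatrix}=\frac{(q)_n}{(q)_m(q)_{n-m}}$ if $m,n-m$ are nonnegative integers, $0$ otherwise. Continued-fraction data: for coprime $1\le b<a$ with $a\ne 2b$ let $\mathrm{cf}(a,b)=(a/b-1)^{s}$ with $s=1$ if $a>2b$, $s=-1$ if $a<2b$. Write $\mathrm{cf}(a,b)=[a_0,\dots,a_n]$ (regular continued fraction with positive integer partial quotients) with $a_n\ge 2$. Put $t_0=0$, $t_j=a_0+\dots+a_{j-1}$ ($1\le j\le n+1$), $d=t_{n+1}$. $\mathcal I$ is the $d\times d$ matrix with $\mathcal I_{j,k}=\delta_{j,k+1}+\delta_{j,k-1}$ if $j\notin\{t_1,\dots,t_{n+1}\}$ and $\delta_{j,k+1}+\delta_{j,k}-\delta_{j,k-1}$ otherwise; $C=2I-\mathcal I$. $\tau_j=2$ for $j<d$, $\tau_d=1$. $\bar m_j=m_j$ for $j<d$ and $\bar m_d=0$; $\bar m^TCm=\sum_{j,k}\bar m_jC_{j,k}m_k$. In the case $a<2b$, $n_j=-\sum_{k=1}^dC_{j,k}m_k$ for $j\ge2$. In the case $a>2b$: $N_i=n_i+\dots+n_{a_0}$, and $n_j=-\sum_{k=a_0+1}^dC_{j,k}m_k$ for $j\ge a_0+2$. *)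

(* Defs.v *)
From HB Require Import structures.
From mathcomp Require Import all_boot all_order all_algebra.
From mathcomp Require Import all_classical all_reals all_analysis.
From mathcomp Require Import complex.
Import Order.TTheory GRing.Theory Num.Theory.
Import numFieldTopology.Exports numFieldNormedType.Exports.

Set Implicit Arguments.
Unset Strict Implicit.
Unset Printing Implicit Defensive.

Local Open Scope ring_scope.
Local Open Scope classical_set_scope.

(* Equip the complex numbers R[i] with the usual (norm-induced) topology,
   i.e. the one of R[i]^o given by MathComp-Analysis for numFieldTypes. *)
HB.instance Definition _ (R : rcfType) := PseudoPointedMetric.copy R[i] (R[i])^o.

Definition qpoch (R : realType) (x p : R[i]) (n : nat) : R[i] :=
  \prod_(i < n) (1 - x * p ^+ i).

Definition qfac (R : realType) (q : R[i]) (n : nat) : R[i] := qpoch q q n.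

Definition qpoch_inf (R : realType) (x p : R[i]) : R[i] :=
  lim ((fun n : nat => qpoch x p n) @ \oo).

Definition qbinom (R : realType) (q : R[i]) (N M : int) : R[i] :=
  if (0 <= M) && (0 <= N - M) then
    qfac q `|N|%N / (qfac q `|M|%N * qfac q `|N - M|%N)
  else 0.

Fixpoint cfval (l : seq nat) : rat :=
  match l with
  | [::] => 0
  | [:: x] => x%:R
  | x :: l' => x%:R + (cfval l')^-1
  end.

Definition cf_target (a b : nat) : rat :=
  if (2 * b < a)%N then a%:R / b%:R - 1 else (a%:R / b%:R - 1)^-1.

Definition is_cf_expansion (a b : nat) (l : seq nat) : Prop :=
  [/\ l != [::], all (fun x => 0 < x)%N l, (2 <= last 0%N l)%N
    & cfval l = cf_target a b].

Definition cf_a0 (l : seq nat) : nat := nth 0%N l 0.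

Definition cf_t (l : seq nat) (j : nat) : nat := \sum_(i < j) nth 0%N l i.

Definition cf_d (l : seq nat) : nat := cf_t l (size l).

Definition in_T (l : seq nat) (j : nat) : bool :=
  has (fun i => cf_t l i == j) (iota 1 (size l)).

(* the matrix \mathcal I (indices j, k in 1..d); delta_{j,k-1} is written (j.+1 == k) *)
Definition Imat (l : seq nat) (j k : nat) : int :=
  if in_T l j then
    (j == k.+1)%:Z + (j == k)%:Z - (j.+1 == k)%:Z
  else (j == k.+1)%:Z + (j.+1 == k)%:Z.

Definition Cmat (l : seq nat) (j k : nat) : int :=
  2 * (j == k)%:Z - Imat l j k.

Definition tau (l : seq nat) (j : nat) : nat :=
  if (j < cf_d l)%N then 2 else 1.

Definition mbar (l : seq nat) (m : nat -> nat) (j : nat) : nat :=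
  if (j < cf_d l)%N then m j else 0.

Definition quad1 (l : seq nat) (m : nat -> nat) : int :=
  \sum_(1 <= j < (cf_d l).+1) \sum_(1 <= k < (cf_d l).+1)
     (mbar l m j)%:Z * Cmat l j k * (m k)%:Z.

Definition nvec1 (l : seq nat) (m : nat -> nat) (j : nat) : int :=
  - \sum_(1 <= k < (cf_d l).+1) Cmat l j k * (m k)%:Z.

Definition term1 (R : realType) (q : R[i]) (l : seq nat) (m : nat -> nat)
  : R[i] :=
  q ^ (quad1 l m) / qfac q (2 * m 1)
  * \prod_(2 <= j < (cf_d l).+1)
      qbinom q ((tau l j * m j)%N%:Z + nvec1 l m j) (tau l j * m j)%N%:Z.

Definition nvec2 (l : seq nat) (m : nat -> nat) (j : nat) : int :=
  - \sum_((cf_a0 l).+1 <= k < (cf_d l).+1) Cmat l j k * (m k)%:Z.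

Definition NN (l : seq nat) (n : nat -> nat) (i : nat) : nat :=
  \sum_(i <= k < (cf_a0 l).+1) n k.

Definition quad2 (l : seq nat) (n m : nat -> nat) : int :=
  (\sum_(1 <= i < (cf_a0 l).+1) ((NN l n i + m (cf_a0 l).+1) ^ 2)%N%:Z)
  + \sum_((cf_a0 l).+1 <= j < (cf_d l).+1)
      \sum_((cf_a0 l).+1 <= k < (cf_d l).+1)
        (mbar l m j)%:Z * Cmat l j k * (m k)%:Z.

(* summand, for the free variables n_1..n_{a_0} (read from n) and
   m_{a_0+1}..m_d (read from m) *)
Definition term2 (R : realType) (q : R[i]) (l : seq nat) (n m : nat -> nat)
  : R[i] :=
  q ^ (quad2 l n m)
  / ((\prod_(1 <= i < (cf_a0 l).+1) qfac q (n i)) * qfac q (2 * m (cf_a0 l).+1))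
  * \prod_((cf_a0 l).+2 <= j < (cf_d l).+1)
      qbinom q ((tau l j * m j)%N%:Z + nvec2 l m j) (tau l j * m j)%N%:Z.

Fixpoint box (d N : nat) : seq (seq nat) :=
  if d is d'.+1 then [seq i :: s | i <- iota 0 N, s <- box d' N]
  else [:: [::]].

(* a sequence s = [x_1; ...; x_d] seen as the 1-indexed vector j |-> x_j *)
Definition vec (s : seq nat) (j : nat) : nat := nth 0%N s j.-1.

(* sum_{m in Z_{>=0}^d} T m = L, as an (absolutely, hence unconditionally)
   convergent sum: the sum of |T m| over all m is finite, and the partial
   sums over the boxes {0..N-1}^d converge to L. *)
Definition sums_Zd (R : realType) (d : nat) (T : seq nat -> R[i]) (L : R[i])
  : Prop :=
  (exists M : R[i], forall N, \sum_(s <- box d N) `|T s| <= M)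
  /\ (fun N : nat => \sum_(s <- box d N) T s) @ \oo --> L.

Definition rhs (R : realType) (q : R[i]) (a b : nat) : R[i] :=
  qpoch_inf (q ^+ (a * b - 1)) (q ^+ (2 * a * b - 1))
  * qpoch_inf (q ^+ (a * b)) (q ^+ (2 * a * b - 1))
  * qpoch_inf (q ^+ (2 * a * b - 1)) (q ^+ (2 * a * b - 1))
  / qpoch_inf q q.

(* Main.v *)
Require Import Defs.
From HB Require Import structures.
From mathcomp Require Import all_boot all_order all_algebra.
From mathcomp Require Import all_classical all_reals all_analysis.
From mathcomp Require Import complex.
From mathcomp Require Import ring lra zify.
Import Order.TTheory GRing.Theory Num.Theory.
Import numFieldTopology.Exports numFieldNormedType.Exports.
Local Open Scope ring_scope.

(* Let [B(L,M,r,s) = [L+M+r-s, L+r] [L+M-r+s, L-r]] (Gaussian binomials) and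
   [F_{a,b}(L,M) = sum_j (-1)^j q^(j((2ab-1)j+1)/2) B(L,M,aj,bj)].  By the q-Saalschuetz sum,
   [sum_i q^(i^2) [2L+M-i, 2L] F_{a,b}(L-i,i) = F_{a+b,b}(L,M)], and with [F_{a,b}(i,L-i)]
   instead one gets [F_{a+b,a}(L,M)].  Starting from [F_{1,1}(L,M) = q^(LM) [L+M, L]] and following
   the continued fraction of [(a/b-1)^(+-1)] backwards, every coprime pair is reached; the
   intermediate values of [L] are the variables [m_j], and the summand of the iterated sum is the
   summand of the theorem.  In the last steps [M], or both sizes, are infinite, where the transform
   is a q-Vandermonde sum; letting the remaining size tend to infinity, the alternating sum becomes a
   theta series, evaluated by the finite Jacobi triple product.  Absolute convergence is free:
   Gaussian binomials have nonnegative coefficients, so each summand at [q] is bounded by the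
   summand at [|q|], to which the same identity applies. *)

Set Implicit Arguments.
Unset Strict Implicit.
Unset Printing Implicit Defensive.

(** * Gaussian binomials *)

(** The two cases differ only in the number e of finite steps taken with both sizes infinite in the
    transform: e = 0 if a < 2b, e = a_0 if a > 2b. The remaining part of the expansion produces the
    slopes (b, a - (e+1)b). A step at infinity adds b^2 to the coefficient c of the quadratic
    exponent and leaves b alone, so e such steps and the final passage to the limit, worth one more
    b^2, lead from b(a - (e+1)b) to ab. Two mismatches shape the rest. The theorem cuts its sum
    through n_j >= 0, whereas the iterated transform cuts it through m_(j+1) <= m_j; these
    conditions differ, so both summands are shown to vanish off the weakly decreasing vectors and
    are compared on those. And the iterated sum comes out ordered by its outermost size, the sum of
    the first e + 1 variables, whereas convergence is asked along boxes; a box is compared with two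
    such weights, and what it has in excess is dominated by a difference of two values of a
    convergent sequence at |q|. *)

Section SumRanges.
Variables (V : nmodType) (f : nat -> V).

(** Which bound is larger often depends on the parameters; [minn] and [maxn] spare the case
    distinction. *)
Lemma sum_ord_tail0 (m n : nat) :
  (forall i, (minn m n <= i < maxn m n)%N -> f i = 0) -> \sum_(i < m) f i = \sum_(i < n) f i.
Proof.
move=> f0; wlog le_mn : m n f0 / (m <= n)%N.
  by move=> H; case: (leqP m n) => h; [|symmetry]; apply: H => //; [rewrite minnC maxnC | lia].
rewrite -(big_mkord xpredT f) -(big_mkord xpredT f) (@big_cat_nat _ _ _ m 0 n) //=.
rewrite [X in _ = _ + X]big1_seq ?addr0 // => i /andP[_]; rewrite mem_index_iota => h.
by apply: f0; lia.
Qed.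

Lemma sum_ord_head0 (s n : nat) :
  (forall i, (i < s)%N -> f i = 0) -> \sum_(i < s + n) f i = \sum_(i < n) f (s + i)%N.
Proof. by move=> f0; rewrite big_split_ord /= big1 ?add0r // => i _; apply: f0. Qed.

Lemma sum_ord_rev (n : nat) : \sum_(i < n.+1) f i = \sum_(i < n.+1) f (n - i)%N.
Proof. by rewrite (reindex_inj rev_ord_inj) /=; apply: eq_bigr => i _; rewrite subSS. Qed.

Lemma sum_ord_center (n : nat) :
  \sum_(i < n.*2.+1) f i = f n + \sum_(i < n) (f (n + i.+1)%N + f (n - i.+1)%N).
Proof.
rewrite -addnn -addnS big_split_ord /= big_ord_recl /= addn0 big_split /=.
rewrite addrCA; congr (_ + _); rewrite addrC; congr (_ + _).
by rewrite (reindex_inj rev_ord_inj).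
Qed.

End SumRanges.

Lemma sum_ord_triangle (V : nmodType) (f : nat -> nat -> V) (m : nat) :
  \sum_(k < m.+1) \sum_(l < (m - k).+1) f k l = \sum_(K < m.+1) \sum_(k < K.+1) f k (K - k)%N.
Proof.
elim: m => [|m IH]; first by rewrite !big_ord1.
rewrite [LHS]big_ord_recr [RHS]big_ord_recr /= -IH.
rewrite [X in _ = _ + X]big_ord_recr /= addrA subnn big_ord1; congr (_ + _).
rewrite -big_split /=; apply: eq_bigr => k _.
by rewrite subSn ?big_ord_recr // -ltnS.
Qed.

(* For natural [n], [tri n] and [tri (- n)] are the binomials [n+1] choose 2 and [n] choose 2. *)
Definition tri (j : int) : nat := (absz (j * (j + 1)))./2.

Lemma triE (j : int) : (tri j)%:Z * 2 = j * (j + 1).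
Proof.
rewrite /tri; case: j => n.
  have -> : absz (n%:Z * (n%:Z + 1)) = (n * n.+1)%N by rewrite -PoszD addn1 -PoszM.
  have : ((n * n.+1)./2.*2 = n * n.+1)%N.
    by rewrite -[RHS]odd_double_half oddM /= andbN.
  by rewrite -muln2; lia.
have -> : absz (Negz n * (Negz n + 1)) = (n * n.+1)%N.
  by rewrite NegzE abszM abszN /= mulnC; congr (_ * _)%N; lia.
have : ((n * n.+1)./2.*2 = n * n.+1)%N.
  by rewrite -[RHS]odd_double_half oddM /= andbN.
by rewrite NegzE -muln2; lia.
Qed.

Lemma triNC (n : nat) : tri (- n%:Z) = (n ^ 2 - tri n)%N.
Proof. by have := triE n; have := triE (- n%:Z); lia. Qed.

Lemma tri_le (n : nat) : (tri n <= n ^ 2)%N.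
Proof. by have := triE n; nia. Qed.

Lemma triN_le (n : nat) : (tri (- n%:Z) <= tri n)%N.
Proof. by have := triE n; have := triE (- n%:Z); nia. Qed.

(** * q-factorials, q-Vandermonde, q-Saalschuetz and the kernels of the transforms *)

Section QSeries.
Variables (F : fieldType) (q : F).

(* [qf q] is convertible to [qfac q], but over an arbitrary field. *)
Definition qf (n : nat) : F := \prod_(i < n) (1 - q * q ^+ i).

Definition qb (n k : nat) : F :=
  if (k <= n)%N then qf n / (qf k * qf (n - k)) else 0.

Lemma qf0 : qf 0 = 1. Proof. by rewrite /qf big_ord0. Qed.

Lemma qfS (n : nat) : qf n.+1 = qf n * (1 - q ^+ n.+1).
Proof. by rewrite /qf big_ord_recr /= exprS. Qed.

Lemma qb_small (n k : nat) : (n < k)%N -> qb n k = 0.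
Proof. by rewrite /qb ltnNge => /negbTE ->. Qed.

Hypothesis qf_neq0 : forall n, qf n != 0.

Lemma qfS_neq0 (n : nat) : 1 - q ^+ n.+1 != 0.
Proof. by have := qf_neq0 n.+1; rewrite qfS mulf_eq0 negb_or => /andP[]. Qed.

Lemma qb0 (n : nat) : qb n 0 = 1.
Proof. by rewrite /qb leq0n subn0 qf0 mul1r divff. Qed.

Lemma qbn (n : nat) : qb n n = 1.
Proof. by rewrite /qb leqnn subnn qf0 mulr1 divff. Qed.

Lemma qb_sub (n k : nat) : (k <= n)%N -> qb n (n - k) = qb n k.
Proof. by move=> kn; rewrite /qb leq_subr kn subKn // [X in _ / X]mulrC. Qed.

Lemma qbE (n k l : nat) : n = (k + l)%N -> qb n k = qf n / (qf k * qf l).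
Proof. by move=> ->; rewrite /qb leq_addr addKn. Qed.

Lemma qbS (n k : nat) : qb n.+1 k.+1 = qb n k.+1 + q ^+ (n - k) * qb n k.
Proof.
have [kn|nk|->] := ltngtP k n; last first.
- by rewrite subnn !qbn qb_small // add0r mulr1.
- by rewrite !qb_small ?mulr0 ?addr0 // ltnW.
have [m ->] : exists m, n = (k + m.+1)%N by exists (n - k).-1; lia.
rewrite (@qbE _ k.+1 m.+1) ?addSn // (@qbE _ k.+1 m) ?addSnnS // (@qbE _ k m.+1) // addKn.
rewrite addnS [qf (k + m).+2]qfS [qf k.+1]qfS [qf m.+1]qfS -addSn -addnS exprD.
have Hx := qfS_neq0 k; have Hy := qfS_neq0 m; have Hk := qf_neq0 k; have Hm := qf_neq0 m.
by field; rewrite Hx Hy Hk Hm.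
Qed.

Lemma qbS' (n k : nat) : qb n.+1 k.+1 = q ^+ k.+1 * qb n k.+1 + qb n k.
Proof.
have [kn|nk|->] := ltngtP k n; last first.
- by rewrite !qbn qb_small // mulr0 add0r.
- by rewrite !qb_small ?mulr0 ?addr0 // ltnW.
rewrite -qb_sub 1?ltnW // subSS -(subnSK kn) qbS (subnSK kn) qb_sub 1?ltnW //.
by rewrite qb_sub // addrC; congr (_ ^+ _ * _ + _); lia.
Qed.

(** Induction on A by Pascal's rule. The subtraction in the exponent is truncated only when n < m -
    k, and then [qb n (m - k)] vanishes. *)
Lemma qb_vandermonde (A n m : nat) :
  qb (A + n) m = \sum_(k < m.+1) q ^+ (k * (n + k - m)) * (qb A k * qb n (m - k)).
Proof.
elim: A m => [|A IH] m.
  rewrite big_ord_recl /= mul0n expr0 qb0 !mul1r subn0 add0n big1 ?addr0 // => i _.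
  by rewrite qb_small // mul0r mulr0.
case: m => [|m]; first by rewrite big_ord_recl big_ord0 !qb0 mul0n expr0 !mulr1 addr0.
rewrite addSn qbS big_ord_recl /= IH big_ord_recl /= -addrA; congr (_ + _).
  by rewrite !qb0.
rewrite IH mulr_sumr.
under [RHS]eq_bigr => i _ do rewrite /bump /= add1n qbS mulrDl mulrDr.
rewrite big_split /=; congr (_ + _).
apply: eq_bigr => i _; rewrite subSS.
have [Ai|iA] := ltnP A i; first by rewrite qb_small // !(mul0r, mulr0).
have [h|h] := ltnP (n + i) m; first by rewrite (@qb_small n) ?(mulr0, mul0r) //; lia.
have [t Ht] : exists t, (n + i = m + t)%N by exists (n + i - m)%N; lia.
have [u uE] : exists u, (A = i + u)%N by exists (A - i)%N; lia.
have -> : (n + i.+1 - m.+1 = t)%N by lia.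
have -> : (n + i - m = t)%N by lia.
have -> : (A + n - m = u + t)%N by lia.
have -> : (A - i = u)%N by lia.
by rewrite mulSn !exprD; ring.
Qed.

Lemma qb_trinomial (A k l : nat) : qb A k * qb (A - k) l = qb A (k + l) * qb (k + l) k.
Proof.
have [h|h] := leqP (k + l) A; last first.
  rewrite [qb A (k + l)]qb_small // mul0r; have [kA|kA] := leqP k A.
    by rewrite [qb _ l]qb_small ?mulr0 //; lia.
  by rewrite qb_small ?mul0r.
have [r ->] : exists r, (A = k + l + r)%N by exists (A - (k + l))%N; lia.
rewrite (@qbE _ k (l + r)) ?addnA // (@qbE _ l r) ?(@qbE _ (k + l) r) ?(@qbE _ k l) //; last by lia.
have -> : (k + l + r - k = l + r)%N by lia.
have H := qf_neq0; have := H k; have := H l; have := H r; have := H (l + r)%N; have := H (k + l)%N.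
by move=> *; field; do !(apply/andP; split).
Qed.

(** Vandermonde for the upper entry K + B, with the summation variable reversed. *)
Lemma qb_vandermonde_diag (B K c : nat) :
  \sum_(k < K.+1) q ^+ (k * (k + c) + (K - k) * (B + K)) * (qb K k * qb B (k + c)) =
  q ^+ (K * (K + c)) * qb (B + K) (K + c).
Proof.
pose f k := q ^+ (k * (B + k - (K + c))) * (qb K k * qb B (K + c - k)).
rewrite [in qb (B + K) _]addnC qb_vandermonde (@sum_ord_tail0 _ f _ K.+1); last first.
  by move=> i h; rewrite /f [qb K i]qb_small ?mul0r ?mulr0 //; lia.
rewrite (@sum_ord_rev _ f) /f mulr_sumr; apply: eq_bigr => -[k /= kK] _.
rewrite qb_sub //; have -> : (K + c - (K - k) = k + c)%N by lia.
have [h|h] := ltnP B (k + c); first by rewrite [qb B _]qb_small // !mulr0.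
rewrite [RHS]mulrA -exprD; congr (_ ^+ _ * _).
have [r ->] : exists r, (K = k + r)%N by exists (K - k)%N; lia.
have [s ->] : exists s, (B = k + c + s)%N by exists (B - (k + c))%N; lia.
have -> : (k + r - k = r)%N by lia.
have -> : (k + c + s + r - (k + r + c) = s)%N by lia.
by ring.
Qed.

(* Vandermonde for [A + m + c] on the right and for [A + B + m - k] on the left reduces both sides to
   sums over [K], matched by [qb_vandermonde_diag]. *)
Lemma qb_saalschutz (A B c m : nat) :
  \sum_(k < m.+1) q ^+ (k * (k + c)) *
     (qb A k * qb B (k + c) * qb (A + B + (m - k)) (m - k)) =
  qb (A + m + c) m * qb (B + m) (m + c).
Proof.
transitivity (\sum_(K < m.+1) qb A K * qb (B + m) (m - K) *
   \sum_(k < K.+1) q ^+ (k * (k + c) + (K - k) * (B + K)) * (qb K k * qb B (k + c))).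
  under [RHS]eq_bigr => K _ do rewrite mulr_sumr.
  pose f k l := qb A (k + l) * qb (B + m) (m - (k + l)) *
     (q ^+ (k * (k + c) + l * (B + (k + l))) * (qb (k + l) k * qb B (k + c))).
  transitivity (\sum_(k < m.+1) \sum_(l < (m - k).+1) f k l); last first.
    rewrite sum_ord_triangle; apply: eq_bigr => K _; apply: eq_bigr => k _.
    by rewrite /f subnKC // -ltnS.
  apply: eq_bigr => -[k /= km] _; have [kA|kA] := leqP k A; last first.
    rewrite [qb A k]qb_small // !mul0r mulr0 big1 // => l _.
    by rewrite /f [qb A _]qb_small ?mul0r //; lia.
  have -> : (A + B + (m - k) = (A - k) + (B + m))%N by lia.
  rewrite qb_vandermonde !mulr_sumr; apply: eq_bigr => l _.
  have -> : (B + m + l - (m - k) = B + (k + l))%N by lia.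
  have T := qb_trinomial A k l; rewrite -subnDA /f exprD.
  transitivity (qb A k * qb (A - k) l * (q ^+ (k * (k + c)) * qb B (k + c) *
    (q ^+ (l * (B + (k + l))) * qb (B + m) (m - (k + l))))); first by ring.
  by rewrite T; ring.
rewrite -addnA qb_vandermonde mulr_suml; apply: eq_bigr => -[K /= Km] _.
rewrite qb_vandermonde_diag; have := qb_trinomial (B + m) (m - K) (K + c).
have -> : (B + m - (m - K) = B + K)%N by lia.
have -> : (m - K + (K + c) = m + c)%N by lia.
have -> : (m + c + K - m = K + c)%N by lia.
move=> T; transitivity (q ^+ (K * (K + c)) * qb A K * (qb (B + m) (m + c) * qb (m + c) (m - K))).
  by rewrite -T; ring.
by ring.
Qed.

(** The first binomial has the complementary lower index M - s. The guard restores the vanishing at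
    negative lower indices, which truncated subtraction would lose, and keeps all four subtractions
    exact. *)
Definition Bq (L M r s : nat) : F :=
  if (r <= L)%N && (s <= M)%N then qb (L + M + r - s) (M - s) * qb (L + M + s - r) (L - r)
  else 0.

Lemma Bq_sym (L M r s : nat) : Bq L M r s = Bq M L s r.
Proof. by rewrite /Bq andbC mulrC [(M + L)%N]addnC. Qed.

Lemma Bq_small (L M r s : nat) : (L < r)%N || (M < s)%N -> Bq L M r s = 0.
Proof. by rewrite /Bq !ltnNge -negb_and => /negbTE ->. Qed.

(** The sizes L - i and i add up to L, so the upper entries of [Bq (L - i) i r s] do not depend on
    i. With i = s + k the sum becomes [qb_saalschutz] for A = L + r - s, B = L + s - r, c = 2s and m
    = M - s. *)
Lemma Bq_burge (L M r s : nat) :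
  \sum_(i < L.+1) q ^+ (i ^ 2) * qb (2 * L + M - i) (2 * L) * Bq (L - i) i r s =
  q ^+ (s ^ 2) * Bq L M (r + s) s.
Proof.
have [/andP[rsL sM]|] := boolP ((r + s <= L)%N && (s <= M)%N); last first.
  rewrite negb_and -!ltnNge => h; rewrite Bq_small // mulr0 big1 // => -[i /= iL] _.
  have [iM|iM] := leqP i M; first by rewrite Bq_small ?mulr0 //; lia.
  by rewrite [qb _ _]qb_small ?mulr0 ?mul0r //; lia.
have [x LE] : exists x, (L = x + r + s)%N by exists (L - (r + s))%N; lia.
have [m ME] : exists m, (M = s + m)%N by exists (M - s)%N; lia.
pose f i := if (i <= L)%N then
  q ^+ (i ^ 2) * qb (2 * L + M - i) (2 * L) * Bq (L - i) i r s else 0.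
transitivity (\sum_(i < L.+1) f i); first by apply: eq_bigr => i _; rewrite /f -ltnS ltn_ord.
rewrite (@sum_ord_tail0 _ f L.+1 (s + m.+1)); last first.
  by move=> i h; rewrite /f; case: leqP => // iL; rewrite [qb _ _]qb_small ?mulr0 ?mul0r //; lia.
rewrite sum_ord_head0; last by move=> i h; rewrite /f Bq_small ?mulr0 ?if_same //; lia.
have := qb_saalschutz (x + 2 * r) (x + 2 * s) (2 * s) m => /(congr1 ( *%R (q ^+ (s ^ 2)))) E.
rewrite /Bq ifT; last by lia.
have -> : (L + M + (r + s) - s = x + 2 * r + m + 2 * s)%N by lia.
have -> : (M - s = m)%N by lia.
have -> : (L + M + s - (r + s) = x + 2 * s + m)%N by lia.
have -> : (L - (r + s) = x)%N by lia.
rewrite -[X in _ * (_ * X)]qb_sub; last by lia.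
have -> : (x + 2 * s + m - x = m + 2 * s)%N by lia.
rewrite -{}E mulr_sumr; apply: eq_bigr => -[k /= km] _; rewrite /f.
have -> : (2 * L + M - (s + k) = x + 2 * r + (x + 2 * s) + (m - k))%N by lia.
rewrite -qb_sub; last by lia.
have -> : (x + 2 * r + (x + 2 * s) + (m - k) - 2 * L = m - k)%N by lia.
have -> : ((s + k) ^ 2 = s ^ 2 + k * (k + 2 * s))%N by lia.
rewrite exprD; have [kx|kx] := leqP k x; last first.
  rewrite [qb (x + 2 * s) _]qb_small ?mulr0 ?mul0r ?mulr0; last by lia.
  by case: leqP => // h; rewrite Bq_small ?mulr0 //; lia.
rewrite ifT; last by lia.
rewrite /Bq ifT; last by lia.
have -> : (L - (s + k) + (s + k) + r - s = x + 2 * r)%N by lia.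
have -> : (s + k - s = k)%N by lia.
have -> : (L - (s + k) + (s + k) + s - r = x + 2 * s)%N by lia.
rewrite -[qb _ (L - _ - _)]qb_sub; last by lia.
have -> : (x + 2 * s - (L - (s + k) - r) = k + 2 * s)%N by lia.
by ring.
Qed.

Lemma Bq_burge_swap (L M r s : nat) :
  \sum_(i < L.+1) q ^+ (i ^ 2) * qb (2 * L + M - i) (2 * L) * Bq i (L - i) r s =
  q ^+ (r ^ 2) * Bq L M (r + s) r.
Proof. by rewrite [(r + s)%N]addnC -Bq_burge; apply: eq_bigr => i _; rewrite Bq_sym. Qed.

(* The limit of [Bq] when one of the two sizes tends to infinity, up to a factor [(q)_oo]. *)
Definition cc (m s : nat) : F := if (s <= m)%N then (qf (m - s) * qf (m + s))^-1 else 0.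

Lemma cc_small (m s : nat) : (m < s)%N -> cc m s = 0.
Proof. by rewrite /cc ltnNge => /negbTE ->. Qed.

(** The case M = oo of [Bq_burge], where [qb (2 * L + M - i) (2 * L)] becomes the constant
    1/(q)_(2L). *)
Lemma cc_burge (L r s : nat) :
  \sum_(i < L.+1) q ^+ (i ^ 2) * Bq (L - i) i r s = qf (2 * L) * (q ^+ (s ^ 2) * cc L (r + s)).
Proof.
have [rsL|h] := leqP (r + s) L; last first.
  by rewrite cc_small // !mulr0 big1 // => -[i /= iL] _; rewrite Bq_small ?mulr0 //; lia.
have [x LE] : exists x, (L = x + r + s)%N by exists (L - (r + s))%N; lia.
pose f i := q ^+ (i ^ 2) * Bq (L - i) i r s.
rewrite (@sum_ord_tail0 _ f L.+1 (s + x.+1)); last first.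
  by move=> i h; rewrite /f Bq_small ?mulr0 //; lia.
rewrite sum_ord_head0; last by move=> i h; rewrite /f Bq_small ?mulr0 //; lia.
have -> : qf (2 * L) * (q ^+ (s ^ 2) * cc L (r + s)) =
    q ^+ (s ^ 2) * qb ((x + 2 * r) + (x + 2 * s)) x.
  rewrite (@qbE _ x (L + (r + s))); last by lia.
  rewrite /cc rsL; have -> : (L - (r + s) = x)%N by lia.
  have -> : (x + 2 * r + (x + 2 * s) = 2 * L)%N by lia.
  by ring.
rewrite qb_vandermonde mulr_sumr; apply: eq_bigr => -[k /= kx] _; rewrite /f.
have -> : (x + 2 * s + k - x = 2 * s + k)%N by lia.
rewrite mulrA -exprD; have -> : (s ^ 2 + k * (2 * s + k) = (s + k) ^ 2)%N by lia.
rewrite /Bq ifT; last by lia.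
have -> : (L - (s + k) + (s + k) + r - s = x + 2 * r)%N by lia.
have -> : (s + k - s = k)%N by lia.
have -> : (L - (s + k) + (s + k) + s - r = x + 2 * s)%N by lia.
by have -> : (L - (s + k) - r = x - k)%N by lia.
Qed.

(** The limit of q-Vandermonde as one upper entry tends to infinity. Over an arbitrary field it is
    proved by recurrences instead: induction on m, and inside it on c. *)
Lemma qf_burge_aux (m c : nat) :
  \sum_(k < m.+1) q ^+ (k * (k + c)) / (qf k * qf (k + c) * qf (m - k)) =
  (qf m * qf (m + c))^-1.
Proof.
pose t m c k := if (k <= m)%N then q ^+ (k * (k + c)) / (qf k * qf (k + c) * qf (m - k)) else 0.
suff tV : \sum_(k < m.+1) t m c k = (qf m * qf (m + c))^-1.
  by rewrite -tV; apply: eq_bigr => k _; rewrite /t -ltnS ltn_ord.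
have t_last m' c' : \sum_(k < m'.+2) t m' c' k = \sum_(k < m'.+1) t m' c' k.
  by rewrite big_ord_recr /= {2}/t ltnn addr0.
have H := qf_neq0; have H1 := qfS_neq0.
elim: m c => [|m IH] c; first by rewrite big_ord1 /t /= !qf0 mulr1 expr0 div1r.
elim: c => [|c IHc].
  (* In the term of index k + 1, write 1 - q^(m+1) = (1 - q^(m-k)) + q^(m-k) (1 - q^(k+1)); the term
     of index 0 is set apart. *)
  have E : (1 - q ^+ m.+1) * \sum_(k < m.+2) t m.+1 0%N k =
      \sum_(k < m.+2) t m 0%N k + q ^+ m.+1 * \sum_(k < m.+1) t m 1%N k.
    have t0 m' : t m' 0%N 0%N = (qf m')^-1 by rewrite /t /= subn0 !qf0 expr0 !mul1r.
    rewrite 2![\sum_(k < m.+2) _]big_ord_recl !t0 mulrDr -addrA 2!mulr_sumr -big_split /=.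
    congr (_ + _); first by rewrite qfS; field; rewrite H H1.
    apply: eq_bigr => -[k /= km] _; rewrite /t /bump /= add1n !addn0 subSS addn1.
    have [r mE] : exists r, m = (k + r)%N by exists (m - k)%N; lia.
    rewrite mE addKn leq_addr ltnS leq_addr; case: r mE => [|r] mE.
      rewrite addn0 ltnn qf0 qfS mulSn exprD; field.
      by rewrite H H1.
    have -> : (k < k + r.+1)%N by lia.
    have -> : (k + r.+1 - k.+1 = r)%N by lia.
    rewrite -addnS [(k.+1 * _)%N]mulSn !exprD !qfS !exprS; field. 
    by rewrite -!exprS !H !H1.
  apply: (mulfI (H1 m)); rewrite E t_last !IH !addn0 addn1 !qfS.
  by field; rewrite H H1.
(* The same splitting of 1 - q^(m+c+2), into the exponents m + 1 - k and k + c + 1. *)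
have E : (1 - q ^+ (m + c.+1).+1) * \sum_(k < m.+2) t m.+1 c.+1 k =
    \sum_(k < m.+2) t m c.+1 k + q ^+ m.+1 * \sum_(k < m.+2) t m.+1 c k.
  rewrite 2!mulr_sumr -big_split /=; apply: eq_bigr => -[k /= km] _.
  rewrite /t -ltnS km; have [r mE] : exists r, m.+1 = (k + r)%N by exists (m.+1 - k)%N; lia.
  case: r mE => [|r] mE.
    have -> : (k <= m)%N = false by lia.
    have -> : ((m + c.+1).+1 = (k + c).+1)%N by lia.
    rewrite mE addn0 subnn qf0 [(k + c.+1)%N]addnS qfS mulnS exprD.
    by field; rewrite !H H1.
  have -> : (k <= m)%N by lia.
  have -> : (m - k = r)%N by lia.
  have -> : ((m + c.+1).+1 = r.+1 + (k + c).+1)%N by lia.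
  rewrite mE addKn [(k + c.+1)%N]addnS [qf (k + c).+1]qfS [qf r.+1]qfS mulnS !exprD; field.
  by rewrite !H !H1.
apply: (mulfI (H1 (m + c.+1)%N)); rewrite E t_last IH IHc addSn addSn addnS !qfS.
by field; rewrite !H !H1.
Qed.

(** Bailey's lemma relative to 1 with both free parameters sent to infinity; m = s + k reduces it to
    [qf_burge_aux] with c = 2s. *)
Lemma cc_bailey (N s : nat) :
  \sum_(m < N.+1) q ^+ (m ^ 2) * cc m s / qf (N - m) = q ^+ (s ^ 2) * cc N s.
Proof.
have [sN|h] := leqP s N; last first.
  by rewrite cc_small // !mulr0 big1 // => -[i /= iL] _; rewrite cc_small ?(mulr0,mul0r) //; lia.
have [m NE] : exists m, (N = s + m)%N by exists (N - s)%N; lia.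
pose f i := q ^+ (i ^ 2) * cc i s / qf (N - i).
rewrite NE -addnS -NE (@sum_ord_head0 _ f); last first.
  by move=> i h; rewrite /f cc_small ?mulr0 ?mul0r //; lia.
rewrite /cc sN; have -> : (N - s = m)%N by lia.
have -> : (N + s = m + 2 * s)%N by lia.
rewrite -qf_burge_aux mulr_sumr; apply: eq_bigr => -[k /= km] _.
rewrite /f /cc leq_addr addKn; have -> : ((s + k) ^ 2 = s ^ 2 + k * (k + 2 * s))%N by lia.
have -> : (s + k + s = k + 2 * s)%N by lia.
have -> : (N - (s + k) = m - k)%N by lia.
by rewrite exprD -!mulrA -invfM !mulrA.
Qed.

End QSeries.

(** * The Burge transform *)

Lemma sum_ord_antisym (V : zmodType) (f : nat -> V) (n : nat) :
  (forall i, (i < n)%N -> f (n + i)%N = - f (n - i.+1)%N) -> \sum_(i < n + n) f i = 0.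
Proof.
move=> fN; rewrite big_split_ord /= (reindex_inj rev_ord_inj) /= -big_split big1 //= => i _.
by rewrite fN // subrr.
Qed.

Lemma sign_eq_odd (R : pzRingType) (a b : nat) : odd a = odd b -> (-1) ^+ a = (-1) ^+ b :> R.
Proof. by move=> ab; rewrite -signr_odd ab signr_odd. Qed.

Section BurgeTree.
Variables (F : fieldType) (q : F).
Hypothesis qf_neq0 : forall n, qf q n != 0.
Local Notation qb := (qb q).

(* The terms [j = n] and [j = - n] of [sum_j (-1)^j q^(j((2c-1)j+1)/2)] together; the exponents are
   natural because [tri (+- n) <= n ^ 2]. *)
Definition wt (c n : nat) : F :=
  if n == 0%N then 1
  else (-1) ^+ n * (q ^+ (c * n ^ 2 - tri n) + q ^+ (c * n ^ 2 - tri (- n%:Z))).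

(** This is how the exponent follows the slopes: ab + b^2 = (a+b)b and ab + a^2 = (a+b)a. Since c >
    0, the subtractions in [wt] are exact. *)
Lemma wt_shift (c s n : nat) : (0 < c)%N -> wt c n * q ^+ ((s * n) ^ 2) = wt (c + s ^ 2) n.
Proof.
move=> c0; rewrite /wt; case: eqP => [->|_]; first by rewrite muln0 mul1r.
rewrite -mulrA mulrDl -!exprD; have := tri_le n; have := triN_le n => h1 h2.
have h3 : (n ^ 2 <= c * n ^ 2)%N by rewrite leq_pmull.
have E : ((c + s ^ 2) * n ^ 2 = c * n ^ 2 + (s * n) ^ 2)%N by lia.
by congr (_ * (_ ^+ _ + _ ^+ _)); rewrite E; lia.
Qed.

(** The value 0 at k = 0, where k - 1 would be truncated, makes both Pascal rules hold for every
    k. *)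
Definition qbp (n k : nat) : F := if k is k'.+1 then qb n k' else 0.

Lemma qb_pascal (n k : nat) : qb n.+1 k = qb n k + q ^+ (n.+1 - k) * qbp n k.
Proof. by case: k => [|k]; rewrite ?qb0 ?mulr0 ?addr0 //= qbS. Qed.

Lemma qb_pascal' (n k : nat) : qb n.+1 k = q ^+ k * qb n k + qbp n k.
Proof. by case: k => [|k]; rewrite ?qb0 ?expr0 ?mulr1 ?addr0 //= qbS'. Qed.

Lemma qbp_small (n k : nat) : (n.+1 < k)%N -> qbp n k = 0.
Proof. by case: k => // k h; apply: qb_small. Qed.

(* Bilateral in [j = x - L], reindexed so that the range is an initial segment of [nat]. *)
Definition alt_sum (L : nat) (f : nat -> F) : F :=
  \sum_(x < L.*2.+1) (-1) ^+ (x + L) * q ^+ tri (x%:Z - L%:Z) * f x.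

Lemma alt_sum_eq (L : nat) (f g : nat -> F) :
  (forall x, (x <= L.*2)%N -> f x = g x) -> alt_sum L f = alt_sum L g.
Proof. by move=> fg; apply: eq_bigr => x _; rewrite fg // -ltnS. Qed.

Lemma alt_sumD (L : nat) (f g : nat -> F) :
  alt_sum L (fun x => f x + g x) = alt_sum L f + alt_sum L g.
Proof. by rewrite /alt_sum -big_split; apply: eq_bigr => x _; rewrite mulrDr. Qed.

Lemma alt_sumZ (L : nat) (a : F) (f : nat -> F) :
  alt_sum L (fun x => a * f x) = a * alt_sum L f.
Proof. by rewrite /alt_sum mulr_sumr; apply: eq_bigr => x _; rewrite mulrCA. Qed.

(* The reflection [x -> 2 L - x] changes the weight by [q ^ j], since [tri (- j) = tri j - j]. *)
Lemma alt_sum_rev (L e : nat) (f g : nat -> F) :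
  (forall x, (x <= L.*2)%N -> g x != 0 ->
     exists2 e', f (L.*2 - x)%N = q ^+ e' * g x & (e' + L = e + x)%N) ->
  (forall x, (x <= L.*2)%N -> g x = 0 -> f (L.*2 - x)%N = 0) ->
  alt_sum L f = q ^+ e * alt_sum L g.
Proof.
move=> fg fg0; rewrite /alt_sum.
rewrite (@sum_ord_rev _ (fun x => (-1) ^+ (x + L) * q ^+ tri (x%:Z - L%:Z) * f x)) mulr_sumr.
apply: eq_bigr => -[x /= xL] _.
have [gx0|gx0] := eqVneq (g x) 0; first by rewrite gx0 fg0 // !mulr0.
have [e' -> e'E] := fg x xL gx0.
rewrite (@sign_eq_odd _ (L.*2 - x + L) (x + L)); last by lia.
rewrite -mulrA [q ^+ tri _ * _]mulrA -exprD.
have -> : (tri ((L.*2 - x)%N%:Z - L%:Z) + e' = e + tri (x%:Z - L%:Z))%N.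
  by have := triE ((L.*2 - x)%N%:Z - L%:Z); have := triE (x%:Z - L%:Z); nia.
by rewrite [q ^+ (e + _)]exprD; ring.
Qed.

(** For N = L + M this is F_{1,1}(L,M) in bilateral form, with j = x - L. *)
Definition dsum (N L : nat) : F := alt_sum L (fun x => qb N x * qb N (L.*2 - x)).

(* Expanding both binomials by the same Pascal rule, or each by a different one, gives two relations
   between [dsum N.+1 L.+1], [dsum N L.+1], [dsum N L] and the mixed sum [V]; the remaining mixed
   sums [Z2] and [Z3] vanish by antisymmetry.  Eliminating [V] also eliminates [dsum N L.+1]. *)
Lemma dsum_step (N L : nat) : (L <= N)%N ->
  (1 - q ^+ L.+1) * dsum N.+1 L.+1 = q ^+ (N - L) * (1 - q ^+ N.+1) * dsum N L.
Proof.
move=> LN; set S := alt_sum L.+1; pose y x := (L.+1.*2 - x)%N.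
have yK x : (x <= L.+1.*2)%N -> y (y x) = x by move=> h; rewrite /y subKn.
pose V := S (fun x => q ^+ (N.+1 - y x) * (qb N x * qbp N (y x))).
have qbp0 x : ~~ (qbp N x == 0) -> (x <= N.+1)%N.
  by apply: contraR; rewrite -ltnNge => h; rewrite qbp_small.
have D4 : S (fun x => qbp N x * qbp N (y x)) = dsum N L.
  pose f x := (-1) ^+ (x + L.+1) * q ^+ tri (x%:Z - L.+1%:Z) * (qbp N x * qbp N (y x)).
  transitivity (\sum_(x < 1 + L.*2.+2) f x); first by [].
  rewrite sum_ord_head0; last by case=> // _; rewrite /f mul0r mulr0.
  rewrite big_ord_recr /= {2}/f add1n /y doubleS subnn !mulr0 addr0.
  apply: eq_bigr => -[x /= xL] _.
  rewrite add1n /f /y doubleS subSS subSn //= (@sign_eq_odd _ (x.+1 + L.+1) (x + L)); last by lia.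
  by have -> : (x.+1%:Z - L.+1%:Z = x%:Z - L%:Z) by lia.
have R1 : S (fun x => q ^+ y x * (qb N x * qb N (y x))) = q ^+ L.+1 * dsum N L.+1.
  apply: alt_sum_rev => x xL; rewrite -/(y x) yK // => g0; last first.
    by rewrite [qb N _ * _]mulrC g0 mulr0.
  by exists x; [rewrite [qb N x * _]mulrC | lia].
have R4 : S (fun x => q ^+ (N.+1 - x) * (qbp N x * qbp N (y x))) = q ^+ (N - L) * dsum N L.
  rewrite -D4; apply: alt_sum_rev => x xL; rewrite -/(y x) yK // => g0.
    exists (N.+1 - y x)%N; first by rewrite [qbp N x * _]mulrC.
    by move: g0; rewrite mulf_eq0 negb_or => /andP[_ /qbp0]; rewrite /y; lia.
  by rewrite [qbp N _ * _]mulrC g0 mulr0.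
have R3 : S (fun x => q ^+ (N.+1 - x) * q ^+ y x * (qbp N x * qb N (y x))) = q ^+ L.+1 * V.
  apply: alt_sum_rev => x xL; rewrite -/(y x) yK // => g0.
    by exists x; [ring | lia].
  by transitivity (q ^+ x * (q ^+ (N.+1 - y x) * (qb N x * qbp N (y x)))); [ring | rewrite g0 mulr0].
have Z2 : S (fun x => qb N x * qbp N (y x)) = 0.
  pose f x := (-1) ^+ (x + L.+1) * q ^+ tri (x%:Z - L.+1%:Z) * (qb N x * qbp N (L.+1.*2 - x)).
  transitivity (\sum_(x < (L.+1 + L.+1).+1) f x); first by rewrite addnn.
  rewrite big_ord_recr /= {2}/f addnn subnn /= !mulr0 addr0 -addnn.
  (* x is paired with 2L + 1 - x, that is, j with - 1 - j: [tri] is unchanged, the sign flips, and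
     the two binomials are exchanged. *)
  apply: (@sum_ord_antisym _ f) => i iL; rewrite /f.
  have -> : (L.+1.*2 - (L.+1 + i) = (L.+1 - i.+1).+1)%N by lia.
  have -> : (L.+1.*2 - (L.+1 - i.+1) = (L.+1 + i).+1)%N by lia.
  rewrite /= (@sign_eq_odd _ (L.+1 + i + L.+1) (L.+1 - i.+1 + L.+1).+1); last by lia.
  rewrite exprS mulN1r.
  have -> : tri ((L.+1 + i)%N%:Z - L.+1%:Z) = tri ((L.+1 - i.+1)%N%:Z - L.+1%:Z).
    by have := triE ((L.+1 + i)%N%:Z - L.+1%:Z);
       have := triE ((L.+1 - i.+1)%N%:Z - L.+1%:Z); nia.
  by ring.
have Z3 : S (fun x => q ^+ (N.+1 - x) * (qbp N x * qb N (y x))) = 0.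
  rewrite -[RHS](mulr0 (q ^+ (N - L))) -Z2; apply: alt_sum_rev => x xL; rewrite -/(y x) yK // => g0.
    exists (N.+1 - y x)%N; first by ring.
    by move: g0; rewrite mulf_eq0 negb_or => /andP[_ /qbp0]; rewrite /y; lia.
  by transitivity (q ^+ (N.+1 - y x) * (qb N x * qbp N (y x))); [ring | rewrite g0 mulr0].
have AA : dsum N.+1 L.+1 = dsum N L.+1 + V + q ^+ (2 * (N - L)) * dsum N L.
  rewrite -D4 -[dsum N L.+1]addr0 -Z3 -alt_sumZ /V -!alt_sumD.
  apply: alt_sum_eq => x xL; rewrite -/(y x) !qb_pascal.
  have [/eqP->|/qbp0 h1] := boolP (qbp N x == 0); first by ring.
  have [/eqP->|/qbp0 h2] := boolP (qbp N (y x) == 0); first by ring.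
  have -> : (2 * (N - L) = (N.+1 - x) + (N.+1 - y x))%N by rewrite /y in h2 *; lia.
  by rewrite exprD; ring.
have AB : dsum N.+1 L.+1 = q ^+ L.+1 * dsum N L.+1 + q ^+ L.+1 * V + q ^+ (N - L) * dsum N L.
  rewrite -R1 -[X in _ = X + _ + _]addr0 -Z2 -R3 -R4 -!alt_sumD.
  apply: alt_sum_eq => x xL; rewrite -/(y x) [qb N.+1 x]qb_pascal [qb N.+1 (y x)]qb_pascal'.
  by ring.
have : q ^+ L.+1 * dsum N.+1 L.+1 - dsum N.+1 L.+1 =
  (q ^+ L.+1 * q ^+ (2 * (N - L)) - q ^+ (N - L)) * dsum N L by rewrite {1}AA AB; ring.
have -> : q ^+ L.+1 * q ^+ (2 * (N - L)) = q ^+ (N - L) * q ^+ N.+1.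
  by rewrite -!exprD; congr (_ ^+ _); lia.
by move=> E; rewrite [LHS]mulrBl mul1r -opprB E; ring.
Qed.

Lemma dsumE (N L : nat) : (L <= N)%N -> dsum N L = q ^+ (L * (N - L)) * qb N L.
Proof.
elim: L N => [|L IH] [|N] // h.
- by rewrite /dsum /alt_sum big_ord1 !qb0 // !mulr1.
- by rewrite /dsum /alt_sum big_ord1 !qb0 // !mulr1.
apply: (mulfI (qfS_neq0 qf_neq0 L)); rewrite dsum_step // IH // subSS mulSn exprD.
have [r ->] : exists r, N = (L + r)%N by exists (N - L)%N; lia.
rewrite addKn (@qbE _ _ _ L.+1 r) // (@qbE _ _ _ L r) // !qfS.
have H := qf_neq0; have H1 := qfS_neq0 qf_neq0.
by field; rewrite !H !H1.
Qed.

Lemma dsum_fold (N L : nat) :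
  dsum N L = \sum_(n < L.+1) wt 1 n * (qb N (L + n) * qb N (L - n)).
Proof.
rewrite /dsum /alt_sum.
pose f x := (-1) ^+ (x + L) * q ^+ tri (x%:Z - L%:Z) * (qb N x * qb N (L.*2 - x)).
rewrite (@sum_ord_center _ f) big_ord_recl /= addn0 subn0 /f subrr.
rewrite -[L.*2 in X in X + _]addnn addnK (@sign_eq_odd _ (L + L) 0) ?oddD ?addbb //.
congr (_ + _); first by rewrite (_ : tri 0 = 0%N) // !expr0 mulr1.
apply: eq_bigr => -[i /= iL] _.
rewrite /bump /= add1n /wt /= mul1n -triNC.
have -> : (i.+1 ^ 2 - tri (- i.+1%:Z) = tri i.+1)%N by have := triNC i.+1; have := tri_le i.+1; lia.
have -> : (L.*2 - (L + i.+1) = L - i.+1)%N by lia.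
have -> : (L.*2 - (L - i.+1) = L + i.+1)%N by lia.
rewrite (@sign_eq_odd _ (L + i.+1 + L) i.+1); last by lia.
rewrite (@sign_eq_odd _ (L - i.+1 + L) i.+1); last by lia.
have -> : (L + i.+1)%N%:Z - L%:Z = i.+1%:Z by lia.
have -> : (L - i.+1)%N%:Z - L%:Z = - i.+1%:Z by lia.
by ring.
Qed.

(* [F_{a,b}(L,M)] of the header; the terms with [L < a n] vanish. *)
Definition burge_sum (a b L M : nat) : F :=
  \sum_(n < L.+1) wt (a * b) n * Bq q L M (a * n) (b * n).

Lemma burge_sum_bound (K a b L M : nat) : (0 < a)%N -> (L <= K)%N ->
  burge_sum a b L M = \sum_(n < K.+1) wt (a * b) n * Bq q L M (a * n) (b * n).
Proof.
move=> a0 LK; apply: (@sum_ord_tail0 _ (fun n => wt (a * b) n * Bq q L M (a * n) (b * n))).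
by move=> i h; rewrite Bq_small ?mulr0 //; nia.
Qed.

Lemma burge_sum11 (L M : nat) : burge_sum 1 1 L M = q ^+ (L * M) * qb (L + M) L.
Proof.
have := @dsumE (L + M) L (leq_addr _ _); rewrite addKn => <-; rewrite dsum_fold.
apply: eq_bigr => -[n /= nL] _; rewrite !mul1n /Bq -ltnS nL /=.
have [nM|nM] := leqP n M; last by rewrite [qb _ (L + n)]qb_small ?mul0r ?mulr0 //; lia.
rewrite addnK -[qb _ (M - n)]qb_sub //; last by lia.
by congr (_ * (qb _ _ * _)); lia.
Qed.

Lemma burge_sum_step (a b L M : nat) : (0 < a)%N -> (0 < b)%N ->
  \sum_(i < L.+1) q ^+ (i ^ 2) * qb (2 * L + M - i) (2 * L) * burge_sum a b (L - i) i =
  burge_sum (a + b) b L M.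
Proof.
move=> a0 b0; under eq_bigr => i _ do
  rewrite (@burge_sum_bound L) ?leq_subr // mulr_sumr.
rewrite exchange_big; apply: eq_bigr => n _ /=.
under eq_bigr => i _ do rewrite mulrCA.
by rewrite -mulr_sumr Bq_burge // mulrA wt_shift ?muln_gt0 ?a0 // !mulnDl mulnn.
Qed.

Lemma burge_sum_step_swap (a b L M : nat) : (0 < a)%N -> (0 < b)%N ->
  \sum_(i < L.+1) q ^+ (i ^ 2) * qb (2 * L + M - i) (2 * L) * burge_sum a b i (L - i) =
  burge_sum (a + b) a L M.
Proof.
move=> a0 b0; under eq_bigr => i _ do
  rewrite (@burge_sum_bound L) // -1?ltnS // mulr_sumr.
rewrite exchange_big; apply: eq_bigr => n _ /=.
under eq_bigr => i _ do rewrite mulrCA.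
rewrite -mulr_sumr Bq_burge_swap // mulrA wt_shift ?muln_gt0 ?a0 // !mulnDl mulnn.
by rewrite [(b * a)%N]mulnC addnC.
Qed.

(* [chain ts L M] iterates the Burge transform, swapping the two sizes at the steps marked
   [true]; [burge_pair ts] is the pair of slopes it produces from [(1, 1)]. *)
Fixpoint chain (ts : seq bool) (L M : nat) : F :=
  if ts is t :: ts' then
    \sum_(m < L.+1) q ^+ ((if t then m : nat else L - m) ^ 2)%N *
      qb (2 * L + M - (if t then m : nat else L - m))%N (2 * L) * chain ts' m (L - m)
  else q ^+ (L * M) * qb (L + M) L.

Fixpoint burge_pair (ts : seq bool) : nat * nat :=
  if ts is t :: ts' then
    let: (a, b) := burge_pair ts' in (a + b, if t then a else b)%N
  else (1, 1)%N.

Lemma burge_pair_gt0 (ts : seq bool) :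
  (0 < (burge_pair ts).1)%N && (0 < (burge_pair ts).2)%N.
Proof. by elim: ts => //= -[] ts; case: burge_pair => a b /= /andP[a0 b0]; lia. Qed.

Lemma chainE (ts : seq bool) (L M : nat) :
  chain ts L M = burge_sum (burge_pair ts).1 (burge_pair ts).2 L M.
Proof.
elim: ts L M => [|t ts IH] L M /=; first by rewrite burge_sum11.
have := burge_pair_gt0 ts; under eq_bigr => m _ do rewrite IH.
case: burge_pair => a b /= /andP[a0 b0]; case: t; first exact: burge_sum_step_swap.
rewrite -burge_sum_step //.
(* An unmarked step has m = L - i as its variable, so the two sums run in opposite directions. *)
pose f i := q ^+ (i ^ 2) * qb (2 * L + M - i) (2 * L) * burge_sum a b (L - i) i.
rewrite [RHS](@sum_ord_rev _ f); apply: eq_bigr => -[m /= mL] _.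
by rewrite /f subKn -1?ltnS //.
Qed.

(* The first step of the chain when the second size is infinite. *)
Lemma chain_first (t : bool) (ts : seq bool) (L : nat) :
  let: (a, b) := burge_pair (t :: ts) in
  (qf q (2 * L))^-1 * \sum_(m < L.+1) q ^+ ((if t then m : nat else L - m) ^ 2)%N *
    chain ts m (L - m) = \sum_(n < L.+1) wt (a * b) n * cc q L (a * n).
Proof.
rewrite /=; have := burge_pair_gt0 ts; under eq_bigr => m _ do rewrite chainE.
case: burge_pair => a b /= /andP[a0 b0].
(* r is the slope attached to the size L - i and s the slope attached to i; both kinds of step then
   become [cc_burge], with new slopes r + s and s. *)
have [r rE] : exists r, r = if t then b else a by exists (if t then b else a).
have [s sE] : exists s, s = if t then a else b by exists (if t then a else b).
have [r0 s0] : (0 < r)%N /\ (0 < s)%N by rewrite rE sE; case: t {rE sE}.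
transitivity ((qf q (2 * L))^-1 * \sum_(i < L.+1) q ^+ (i ^ 2) *
    \sum_(n < L.+1) wt (r * s) n * Bq q (L - i) i (r * n) (s * n)).
  congr (_ * _); case: t rE sE => -> -> {r s r0 s0}.
    apply: eq_bigr => m _; rewrite (@burge_sum_bound L) // -1?ltnS //; congr (_ * _).
    by apply: eq_bigr => n _; rewrite mulnC Bq_sym.
  pose f i := q ^+ (i ^ 2) * \sum_(n < L.+1) wt (a * b) n * Bq q (L - i) i (a * n) (b * n).
  rewrite [RHS](@sum_ord_rev _ f); apply: eq_bigr => -[m /= mL] _.
  by rewrite /f subKn -1?ltnS // (@burge_sum_bound L).
under [X in _ * X = _]eq_bigr => i _ do rewrite mulr_sumr.
rewrite exchange_big mulr_sumr; apply: eq_bigr => n _ /=.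
under eq_bigr => i _ do rewrite mulrCA.
rewrite -mulr_sumr cc_burge // mulrCA mulKf // mulrA wt_shift ?muln_gt0 ?r0 //.
have -> : (r * s + s ^ 2 = (r + s) * s)%N by rewrite mulnDl mulnn.
by rewrite -mulnDl; congr (wt (_ * _) _ * cc q L (_ * _)); rewrite ?rE ?sE; case: (t); lia.
Qed.

(** The beta side of a Bailey pair relative to 1 whose alpha side lives on the multiples of b. The
    parameter c is kept apart from b because a Bailey step changes c only. *)
Definition bailey_sum (c b m : nat) : F := \sum_(n < m.+1) wt c n * cc q m (b * n).

Lemma bailey_sum_step (c b N : nat) : (0 < c)%N -> (0 < b)%N ->
  \sum_(m < N.+1) q ^+ (m ^ 2) / qf q (N - m) * bailey_sum c b m = bailey_sum (c + b ^ 2) b N.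
Proof.
move=> c0 b0.
have E m : (m <= N)%N -> bailey_sum c b m = \sum_(n < N.+1) wt c n * cc q m (b * n).
  move=> mN; apply: (@sum_ord_tail0 _ (fun n => wt c n * cc q m (b * n))) => n h.
  by rewrite cc_small ?mulr0 //; nia.
under eq_bigr => m _ do rewrite E -1?ltnS // mulr_sumr.
rewrite exchange_big; apply: eq_bigr => n _ /=.
rewrite -wt_shift // -mulrA -cc_bailey // mulr_sumr; apply: eq_bigr => m _.
by rewrite mulrCA; congr (_ * _); ring.
Qed.

Lemma bailey_sum_iter (e c b : nat) (g : nat -> F) (N : nat) : (0 < c)%N -> (0 < b)%N ->
  (forall m, g m = bailey_sum c b m) ->
  iter e (fun g N => \sum_(m < N.+1) q ^+ (m ^ 2) / qf q (N - m) * g m) g N =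
  bailey_sum (c + e * b ^ 2) b N.
Proof.
move=> c0 b0 gE; elim: e N => [|e IH] N; first by rewrite /= gE mul0n addn0.
rewrite iterS; under eq_bigr => m _ do rewrite IH.
by rewrite bailey_sum_step ?addn_gt0 ?c0 // -addnA -mulSnr.
Qed.

End BurgeTree.

(** * Summation over boxes *)

Lemma big_boxS (V : nmodType) (d N : nat) (P : pred (seq nat)) (f : seq nat -> V) :
  \sum_(s <- box d.+1 N | P s) f s = \sum_(i < N) \sum_(s <- box d N | P (nat_of_ord i :: s)) f (nat_of_ord i :: s).
Proof.
rewrite /= big_mkcond big_allpairs_dep -{1}[N]subn0 -/(index_iota 0 N) big_mkord.
by apply: eq_bigr => i _; rewrite -big_mkcond.
Qed.

(** Places sums over boxes of different sizes on one index set, where they can be compared term by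
    term. *)
Lemma box_restrict (V : nmodType) (d N K : nat) (P : pred (seq nat)) (f : seq nat -> V) :
  (N <= K)%N ->
  \sum_(s <- box d N | P s) f s = \sum_(s <- box d K | P s && all (fun x => x < N)%N s) f s.
Proof.
move=> NK; elim: d P f => [|d IH] P f; first by rewrite /= !big_cons !big_nil andbT.
rewrite !big_boxS.
pose g i := \sum_(s <- box d K | P (i :: s) && all (fun x => x < N)%N (i :: s)) f (i :: s).
rewrite -/(\sum_(i < K) g i) -(@sum_ord_tail0 _ g N K); last first.
  by move=> i h; rewrite /g big1 // => s /andP[_] /= /andP[]; lia.
by apply: eq_bigr => i _; rewrite IH /g; apply: eq_bigl => s /=; rewrite ltn_ord.
Qed.

Lemma size_box (d N : nat) (s : seq nat) : s \in box d N -> size s = d.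
Proof. by elim: d s => [|d IH] s /=; [case: s | case/allpairsP => -[i t] /= [_ /IH <- ->]]. Qed.

(** * Summands of the iterated transform *)

Section Terms.
Variables (F : fieldType) (q : F).
Local Notation qb := (qb q).
Local Notation qf := (qf q).

Fixpoint chain_term (ts : seq bool) (L M : nat) (s : seq nat) : F :=
  match ts, s with
  | t :: ts', m :: s' =>
      if (m <= L)%N then
        q ^+ ((if t then m else L - m) ^ 2)%N *
        qb (2 * L + M - (if t then m else L - m))%N (2 * L) * chain_term ts' m (L - m) s'
      else 0
  | _, _ => q ^+ (L * M) * qb (L + M) L
  end.

Definition tail_term (bs : seq bool) (s : seq nat) : F :=
  match bs, s with
  | t :: ts, m :: m' :: s' =>
      q ^+ (m ^ 2) / qf (2 * m) *
      (if (m' <= m)%N then q ^+ ((if t then m' else m - m') ^ 2)%N * chain_term ts m' (m - m') s'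
       else 0)
  | _, _ => 0
  end.

(** The first e entries are the n_i and the next one is m_(e+1), so [sumn (take e.+1 s)] is N_1 +
    m_(e+1), the size reached at this Bailey step. The values on lists that are too short keep the
    bound by the summand at |q| valid for all lists. *)
Fixpoint full_term (e : nat) (bs : seq bool) (s : seq nat) : F :=
  match e, s with
  | e'.+1, n :: s' => q ^+ (sumn (take e.+1 s) ^ 2) / qf n * full_term e' bs s'
  | _, _ => tail_term bs s
  end.

Lemma sum_chain_term (ts : seq bool) (N L M : nat) : (L < N)%N ->
  \sum_(s <- box (size ts) N) chain_term ts L M s = chain q ts L M.
Proof.
elim: ts L M => [|t ts IH] L M LN; first by rewrite /= big_seq1.
rewrite [LHS]big_boxS.
pose g m := \sum_(s <- box (size ts) N) chain_term (t :: ts) L M (m :: s).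
rewrite -/(\sum_(i < N) g i) (@sum_ord_tail0 _ g N L.+1); last first.
  by move=> i h; rewrite /g big1 // => s _ /=; rewrite ifF //; lia.
apply: eq_bigr => -[m /= mL] _; rewrite /g.
under eq_bigr => s _ do rewrite /= -ltnS mL.
by rewrite -mulr_sumr IH //; lia.
Qed.

Definition chain_head (bs : seq bool) (m : nat) : F :=
  if bs is t :: ts then
    (qf (2 * m))^-1 * \sum_(m' < m.+1) q ^+ ((if t then m' : nat else m - m') ^ 2)%N *
      chain q ts m' (m - m')
  else 0.

(** At weight M every nonzero summand has all its entries at most M, so a box with N > M cuts
    nothing off. The entry n is M - m, the difference of two consecutive sizes of the Bailey
    steps. *)
Lemma sum_full_term (e : nat) (bs : seq bool) (N M : nat) : (M < N)%N -> bs != [::] ->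
  \sum_(s <- box (e + (size bs).+1) N | sumn (take e.+1 s) == M) full_term e bs s =
  q ^+ (M ^ 2) *
    iter e (fun g N => \sum_(m < N.+1) q ^+ (m ^ 2) / qf (N - m) * g m) (chain_head bs) M.
Proof.
move=> MN; case: bs => // t ts _; elim: e M MN => [|e IH] M MN.
  rewrite add0n big_boxS (bigD1 (Ordinal MN)) //= [X in _ + X]big1 ?addr0; last first.
    move=> i iM; rewrite big1 // => s; rewrite take0 /= addn0 => /eqP iE; case/eqP: iM.
    exact: val_inj.
  rewrite mulrA (eq_bigl xpredT); last by move=> s; rewrite take0 /= addn0 eqxx.
  rewrite -/(box (size ts).+1 N) big_boxS mulr_sumr.
  pose g m' := \sum_(s <- box (size ts) N) tail_term (t :: ts) (M :: m' :: s).
  rewrite -/(\sum_(i < N) g i) (@sum_ord_tail0 _ g N M.+1); last first.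
    by move=> i h; rewrite /g big1 // => s _ /=; rewrite ifF ?mulr0 //; lia.
  apply: eq_bigr => -[m' /= mM] _; rewrite /g.
  under eq_bigr => s _ do rewrite /= -ltnS mM mulrA.
  by rewrite -mulr_sumr sum_chain_term ?mulrA //; lia.
rewrite addSn big_boxS.
pose g n := \sum_(s <- box (e + (size (t :: ts)).+1) N | sumn (take e.+2 (n :: s)) == M)
  full_term e.+1 (t :: ts) (n :: s).
rewrite -/(\sum_(i < N) g i) (@sum_ord_tail0 _ g N M.+1); last first.
  by move=> i h; rewrite /g big1 // => s /=; lia.
rewrite sum_ord_rev iterS mulr_sumr; apply: eq_bigr => -[m /= mM] _; rewrite /g.
rewrite (eq_bigl (fun s => sumn (take e.+1 s) == m)); last by move=> s /=; lia.
have -> : forall a b c, a * (q ^+ (m ^ 2) / b * c) = a / b * (q ^+ (m ^ 2) * c) :> F.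
  by move=> a b c; ring.
rewrite -IH; last by lia.
rewrite mulr_sumr; apply: eq_bigr => s /eqP sm.
by rewrite [full_term e.+1 _ _]/= -/(take e.+1 s) sm; congr (_ ^+ (_ ^ 2) / _ * _); lia.
Qed.

Lemma sum_full_term_lt (e : nat) (bs : seq bool) (N K : nat) : (K <= N)%N -> bs != [::] ->
  \sum_(s <- box (e + (size bs).+1) N | (sumn (take e.+1 s) < K)%N) full_term e bs s =
  \sum_(M < K) q ^+ (M ^ 2) *
    iter e (fun g N => \sum_(m < N.+1) q ^+ (m ^ 2) / qf (N - m) * g m) (chain_head bs) M.
Proof.
move=> KN bs0; elim: K KN => [|K IH] KN; first by rewrite big_ord0 big_pred0.
rewrite big_ord_recr /= -IH -?(@sum_full_term e bs N) //; last by lia.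
rewrite (bigID (fun s => sumn (take e.+1 s) == K)) /= addrC.
by congr (_ + _); apply: eq_bigl => s; lia.
Qed.

End Terms.

(** * Termwise bounds by the summand at [|q|] *)

Section Norms.
Variables (F : numFieldType) (q : F).
Hypothesis q1 : `|q| < 1.

Lemma qf_norm_gt0 (n : nat) : 0 < qf `|q| n.
Proof.
by apply: prodr_gt0 => i _; rewrite subr_gt0 -exprS exprn_ilt1 ?normr_ge0.
Qed.

Lemma qf_neq0_lt1 (n : nat) : qf q n != 0.
Proof.
apply/prodf_neq0 => i _; rewrite subr_eq0 -exprS; apply/eqP => E.
by have := @exprn_ilt1 _ i.+1 `|q| (normr_ge0 _) q1; rewrite -normrX -E normr1 ltxx.
Qed.

Lemma norm_qfV (n : nat) : `|(qf q n)^-1| <= (qf `|q| n)^-1.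
Proof.
rewrite normfV lef_pV2 ?posrE ?normr_gt0 ?qf_neq0_lt1 ?qf_norm_gt0 //.
rewrite normr_prod; apply: ler_prod => i _; rewrite -exprS -exprS.
rewrite subr_ge0 ltW ?exprn_ilt1 ?normr_ge0 //= -normrX.
by apply: le_trans (lerB_dist _ _); rewrite normr1.
Qed.

(** Pascal's rule expresses [qb] through powers of q with positive signs, so the triangle inequality
    propagates by induction; the quotient of factorials would not give this bound. *)
Lemma norm_qb (n k : nat) : `|qb q n k| <= qb `|q| n k.
Proof.
have H := qf_neq0_lt1; have H' m : qf `|q| m != 0 by rewrite gt_eqF ?qf_norm_gt0.
elim: n k => [|n IH] [|k]; rewrite ?qb0 ?normr1 // ?(qb_small _ (ltn0Sn k)) ?normr0 //.
rewrite !qbS //; apply: le_trans (ler_normD _ _) _.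
by rewrite normrM normrX lerD // ler_wpM2l ?exprn_ge0.
Qed.

Lemma norm_chain_term (ts : seq bool) (L M : nat) (s : seq nat) :
  `|chain_term q ts L M s| <= chain_term `|q| ts L M s.
Proof.
have base L' M' : `|q ^+ (L' * M') * qb q (L' + M') L'| <= `|q| ^+ (L' * M') * qb `|q| (L' + M') L'.
  by rewrite normrM normrX ler_wpM2l ?exprn_ge0 ?norm_qb.
elim: ts L M s => [|t ts IH] L M [|m s] //=; case: ifP => _; last by rewrite normr0.
by rewrite !normrM normrX ler_pM ?mulr_ge0 ?exprn_ge0 // ler_wpM2l ?exprn_ge0 ?norm_qb.
Qed.

Lemma norm_full_term (e : nat) (bs : seq bool) (s : seq nat) :
  `|full_term q e bs s| <= full_term `|q| e bs s.
Proof.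
have tail s' : `|tail_term q bs s'| <= tail_term `|q| bs s'.
  case: bs s' => [|t ts] [|m [|m' s']] /=; rewrite ?normr0 //.
  rewrite !normrM normrX ler_pM ?mulr_ge0 ?exprn_ge0 //.
    by rewrite ler_wpM2l ?exprn_ge0 // norm_qfV.
  case: ifP => _; rewrite ?normr0 // normrM normrX ler_wpM2l ?exprn_ge0 //.
  exact: norm_chain_term.
elim: e s => [|e IH] [|n s] //=.
by rewrite !normrM normrX ler_pM ?mulr_ge0 ?exprn_ge0 // ler_wpM2l ?exprn_ge0 // norm_qfV.
Qed.

End Norms.

(** * The summand as an iterated Burge transform *)

Lemma qbinom_qb (R : realType) (q : R[i]) (a : nat) (z : int) :
  qbinom q (a%:Z + z) a%:Z = if 0 <= z then qb q (a + `|z|) a else 0.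
Proof.
rewrite /qbinom [a%:Z + z - _]addrAC subrr add0r /=; case: z => // n.
by rewrite /qb -PoszD /= leq_addr addKn.
Qed.

Lemma sum_delta (a b c : nat) (f : nat -> int) :
  \sum_(a <= k < b) (c == k)%:Z * f k = if (a <= c < b)%N then f c else 0.
Proof.
case: ifP => cab.
  rewrite (bigD1_seq c) ?mem_index_iota ?iota_uniq //= eqxx mul1r big1 ?addr0 //.
  by move=> i ic; rewrite eq_sym (negbTE ic) mul0r.
rewrite big1_seq // => i /andP[_]; rewrite mem_index_iota => iab.
by case: eqP => [ci|]; [rewrite ci iab in cab | rewrite mul0r].
Qed.

Lemma full_termE (F : fieldType) (q : F) (e : nat) (bs : seq bool) (s : seq nat) :
  (e < size s)%N ->
  full_term q e bs s =
  q ^+ (\sum_(1 <= i < e.+1) (\sum_(i <= k < e.+1) vec s k + vec s e.+1) ^ 2) /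
    (\prod_(1 <= i < e.+1) qf q (vec s i)) * tail_term q bs (drop e s).
Proof.
elim: e s => [|e IH] [|n s] // es.
  by rewrite !big_geq // drop0 expr0 divr1 mul1r; case: s es.
have sum_take (k : nat) (u : seq nat) : (k <= size u)%N -> sumn (take k u) = (\sum_(1 <= i < k.+1) vec u i)%N.
  elim: k u => [|k IHk] u ku; first by rewrite take0 big_geq.
  case: u ku => // x u ku; rewrite big_ltn //= IHk //; congr (_ + _)%N.
  by rewrite !big_add1.
rewrite [LHS]/= -/(take e.+2 (n :: s)) IH //.
rewrite sum_take //; have E1 (G : nat -> nat) : (\sum_(1 <= i < e.+2) G i = G 1 + \sum_(1 <= i < e.+1) G i.+1)%N.
  by rewrite big_ltn // big_add1.
have E2 (G : nat -> F) : \prod_(1 <= i < e.+2) G i = G 1%N * \prod_(1 <= i < e.+1) G i.+1.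
  by rewrite big_ltn // big_add1.
rewrite big_nat_recr // E1 E2 /=.
have -> : (\sum_(1 <= i < e.+1) (\sum_(i.+1 <= k < e.+2) vec (n :: s) k + vec (n :: s) e.+2) ^ 2 =
           \sum_(1 <= i < e.+1) (\sum_(i <= k < e.+1) vec s k + vec s e.+1) ^ 2)%N.
  apply: eq_big_nat => i /andP[i0 ie]; rewrite big_add1 /=; congr ((_ + _) ^ 2)%N.
  by apply: eq_big_nat => -[|k] //; lia.
rewrite exprD invfM !mulrA; congr (_ * _).
have -> : \prod_(1 <= i < e.+1) qf q (vec (n :: s) i.+1) = \prod_(1 <= i < e.+1) qf q (vec s i).
  by apply: eq_big_nat => -[|i].
rewrite (E1 (vec (n :: s))) (_ : \sum_(1 <= i < e.+1) vec (n :: s) i.+1 = \sum_(1 <= i < e.+1) vec s i)%N.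
  by rewrite -addnA /vec /=; ring.
by apply: eq_big_nat => -[|i].
Qed.

Section OffsetTerm.
Variables (R : realType) (q : R[i]) (l : seq nat) (e : nat).
Local Notation d := (cf_d l).

(* Both [term1] and [term2] are instances, with [e = 0] and [e = cf_a0 l]. *)
Definition off_row (m : nat -> nat) (j : nat) : int :=
  \sum_(e.+1 <= k < d.+1) Cmat l j k * (m k)%:Z.

Definition off_term (n m : nat -> nat) : R[i] :=
  q ^ (\sum_(1 <= i < e.+1) ((\sum_(i <= k < e.+1) n k + m e.+1) ^ 2)%N%:Z +
       \sum_(e.+1 <= j < d.+1) \sum_(e.+1 <= k < d.+1) (mbar l m j)%:Z * Cmat l j k * (m k)%:Z)
  / ((\prod_(1 <= i < e.+1) qfac q (n i)) * qfac q (2 * m e.+1))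
  * \prod_(e.+2 <= j < d.+1)
      qbinom q ((tau l j * m j)%N%:Z + - off_row m j) (tau l j * m j)%N%:Z.

Variable m : nat -> nat.

(** Reading 0 outside e < j <= d lets the first and last rows of C obey the general formula. *)
Definition off_val (j : nat) : int := if (e < j <= d)%N then (m j)%:Z else 0.

Lemma off_rowE (j : nat) : (e < j <= d)%N ->
  off_row m j = if in_T l j then off_val j - off_val j.-1 + off_val j.+1
                else 2 * off_val j - off_val j.-1 - off_val j.+1.
Proof.
move=> /andP[ej jd]; rewrite /off_row /Cmat.
have S c : \sum_(e.+1 <= k < d.+1) (c == k)%:Z * (m k)%:Z = off_val c.
  by rewrite sum_delta ltnS.
have E k : (j == k.+1) = (j.-1 == k) by apply/eqP/eqP; lia.
rewrite /Imat -!S; case: in_T; rewrite ?mulr_sumr -!sumrN -!big_split /=.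
  by apply: eq_bigr => k _; rewrite E; ring.
by apply: eq_bigr => k _; rewrite E; ring.
Qed.

(** The index i of the Burge step from m_j to m_(j+1): the next first size is i at a row of T and
    m_j - i elsewhere. *)
Definition step_val (j : nat) : int :=
  if in_T l j then off_val j.+1 else off_val j - off_val j.+1.

(* With [g j = m_j (m_(j-1) - m_j)] one has [m_j (C m)_j = i_j ^ 2 + g (j + 1) - g j]. *)
Lemma off_quad : (e.+1 < d)%N ->
  \sum_(e.+1 <= j < d.+1) \sum_(e.+1 <= k < d.+1) (mbar l m j)%:Z * Cmat l j k * (m k)%:Z =
  (m e.+1)%:Z ^+ 2 + \sum_(e.+1 <= j < d) step_val j ^+ 2 +
  (m d)%:Z * ((m d.-1)%:Z - (m d)%:Z).
Proof.
move=> ed; pose g j := off_val j * (off_val j.-1 - off_val j).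
have E j : (e < j < d)%N ->
    \sum_(e.+1 <= k < d.+1) (mbar l m j)%:Z * Cmat l j k * (m k)%:Z =
    step_val j ^+ 2 + (g j.+1 - g j).
  move=> /andP[ej jd]; under eq_bigr => k _ do rewrite -mulrA.
  rewrite -mulr_sumr.
  change (\sum_(e.+1 <= i < d.+1) Cmat l j i * (m i)%:Z) with (off_row m j).
  have ejd : (e < j <= d)%N by rewrite ej ltnW.
  rewrite (off_rowE ejd).
  rewrite /mbar jd /g /step_val.
  rewrite /=.
  have -> : (m j)%:Z = off_val j by rewrite /off_val ej ltnW.
  by case: in_T; ring.
rewrite big_nat_recr /=; last by lia.
rewrite [X in _ + X]big1 ?addr0; last by move=> k _; rewrite /mbar ltnn !mul0r.
(* Of the telescoped ends, g (e+1) gives - m_(e+1)^2 because [off_val e] is 0, and g d is the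
   exponent L M of F_{1,1} at the end of the chain. *)
rewrite (eq_big_nat _ _ E) big_split /= telescope_sumr; last by lia.
rewrite /g /off_val /= !ltnn !ltnS !leqnn.
have -> : (e < d)%N by lia.
have -> : (e < d.-1)%N by lia.
have -> : (d.-1 <= d)%N by lia.
by rewrite /=; ring.
Qed.

(* At rows outside [T], [0 <= n_j] is convexity of [m], so [m_(j+1) <= m_j] propagates downwards from
   row [d]. *)
Lemma off_support : (e.+1 < d)%N -> in_T l d ->
  \prod_(e.+2 <= j < d.+1)
      qbinom q ((tau l j * m j)%N%:Z + - off_row m j) (tau l j * m j)%N%:Z != 0 ->
  forall j, (e < j < d)%N -> (m j.+1 <= m j)%N.
Proof.
move=> ed Td nz.
have row_le0 j : (e.+1 < j <= d)%N -> off_row m j <= 0.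
  move=> /andP[ej jd]; rewrite -oppr_ge0; apply/negPn/negP => h; move: nz.
  rewrite prodf_seq_neq0 => /allP /(_ j); rewrite mem_index_iota ej ltnS jd => /(_ isT) /=.
  by rewrite qbinom_qb (negbTE h) eqxx.
suff H k j : (j + k = d.-1)%N -> (e < j)%N -> (m j.+1 <= m j)%N.
  by move=> j /andP[ej jd]; apply: (H (d.-1 - j)%N) => //; lia.
elim: k j => [|k IH] j jk ej.
  have := row_le0 d; rewrite off_rowE; last by lia.
  rewrite Td /off_val.
  have -> : (e < d <= d)%N by lia.
  have -> : (e < d.-1 <= d)%N by lia.
  have -> : (e < d.+1 <= d)%N = false by lia.
  have -> : d.-1 = j by lia.
  have -> : m d = m j.+1 by congr m; lia.
  by rewrite leqnn (_ : (e.+1 < d)%N) // => /(_ isT); lia.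
have := IH j.+1; have := row_le0 j.+1; rewrite off_rowE; last by lia.
rewrite /off_val /=.
have -> : (e < j.+1 <= d)%N by lia.
have -> : (e < j.+2 <= d)%N by lia.
have -> : (e < j <= d)%N by lia.
by case: in_T; lia.
Qed.

End OffsetTerm.

Section OffsetFull.
Variables (R : realType) (q : R[i]) (l : seq nat) (e : nat) (s : seq nat).
Local Notation d := (cf_d l).
Hypotheses (ed : (e.+1 < d)%N) (Td : in_T l d) (sd : size s = d).
Local Notation f := (vec s).

Definition step_types (p : nat) : seq bool := [seq in_T l j | j <- iota p (d - p)].

Definition step_nat (j : nat) : nat := if in_T l j then f j.+1 else (f j - f j.+1)%N.

Lemma step_typesS (p : nat) : (p < d)%N -> step_types p = in_T l p :: step_types p.+1.
Proof. by move=> pd; rewrite /step_types subnS; case: (d - p)%N (subn_gt0 p d) => [|r] //=; rewrite pd. Qed.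

Lemma drop_vec (p : nat) : (p < d)%N -> drop p s = f p.+1 :: drop p.+1 s.
Proof. by move=> pd; rewrite (drop_nth 0%N) ?sd. Qed.

(** The counterpart of [off_support] for the chain: either summand can be nonzero only on weakly
    decreasing vectors, where the truncated differences are exact. *)
Lemma chain_term_support (p M : nat) :
  chain_term q (step_types p) (f p) M (drop p s) != 0 ->
  forall j, (p <= j < d)%N -> (f j.+1 <= f j)%N.
Proof.
have [r] := ubnP (d - p); elim: r p M => // r IH p M pr nz j /andP[pj jd].
have pd : (p < d)%N by lia.
have pr' : (d - p.+1 < r)%N by lia.
move: nz; rewrite (step_typesS pd) (drop_vec pd) [chain_term _ _ _ _ _]/=.
case: ifP => [fp|_]; last by rewrite eqxx.
rewrite mulf_eq0 negb_or => /andP[_ /(IH _ _ pr') H].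
by move: pj; rewrite leq_eqVlt => /orP[/eqP <- //|pj]; apply: H; lia.
Qed.

Hypothesis supp : forall j, (e < j < d)%N -> (f j.+1 <= f j)%N.

Lemma step_natE (j : nat) : (e < j < d)%N -> step_val l e f j = (step_nat j)%:Z.
Proof.
move=> jed; have := supp jed; rewrite /step_val /step_nat /off_val.
have -> : (e < j <= d)%N by lia.
have -> : (e < j.+1 <= d)%N by lia.
by case: in_T => //; lia.
Qed.

(** At row p the sizes are L = m_p and M = m_(p-1) - m_p, and n_p = M - i, so the upper entry 2L + M
    - i is 2 m_p + n_p. At row d the binomial is that of F_{1,1}, with lower index L instead of 2L;
    hence tau_d = 1. *)
Lemma chain_termE (p : nat) : (e.+1 < p <= d)%N ->
  chain_term q (step_types p) (f p) (f p.-1 - f p) (drop p s) =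
  q ^+ (\sum_(p <= j < d) step_nat j ^ 2 + f d * (f d.-1 - f d)) *
  \prod_(p <= j < d.+1) qbinom q ((tau l j * f j)%N%:Z + - off_row l e f j) (tau l j * f j)%N%:Z.
Proof.
have [r] := ubnP (d - p); elim: r p => // r IH p pr /andP[ep pd].
have fp : (f p <= f p.-1)%N by have := @supp p.-1; rewrite prednK; [apply; lia | lia].
rewrite [in X in _ * X]big_ltn ?ltnS // qbinom_qb.
move: pd; rewrite leq_eqVlt => /orP[/eqP pd|pd].
  rewrite off_rowE; last by lia.
  subst p; rewrite /step_types subnn /= !big_geq // mulr1 add0n /tau ltnn mul1n Td.
  rewrite /off_val.
  have -> : (e < d <= d)%N by lia.
  have -> : (e < d.-1 <= d)%N by lia.
  have -> : (e < d.+1 <= d)%N = false by lia.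
  rewrite ifT; last by lia.
  by congr (_ * qb q (_ + _) _); lia.
have rowE : - off_row l e f p = (f p.-1 - f p)%N%:Z - (step_nat p)%:Z.
  rewrite -step_natE ?off_rowE /step_val; try lia.
  have -> : (f p.-1 - f p)%N%:Z = off_val l e f p.-1 - off_val l e f p.
    rewrite /off_val; have -> : (e < p.-1 <= d)%N by lia.
    have -> : (e < p <= d)%N by lia.
    by lia.
  by case: in_T; ring.
have sp : (step_nat p <= f p)%N by have := @supp p; rewrite /step_nat; case: in_T; lia.
rewrite step_typesS // drop_vec //= supp; last by lia.
rewrite -/(step_nat p) -[in X in chain_term _ _ _ X]/(p.+1.-1) IH; try lia.
rewrite rowE [in X in q ^+ X * (_ * _)]big_ltn //.
have -> : tau l p = 2%N by rewrite /tau pd.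
(* If n_p < 0, the binomial of the chain vanishes as well, its upper entry being below 2 m_p. *)
case: ifP => h; last by rewrite qb_small ?mulr0 ?mul0r ?mulr0 //; lia.
have -> : (2 * f p + absz ((f p.-1 - f p)%N%:Z - (step_nat p)%:Z) =
           2 * f p + (f p.-1 - f p) - step_nat p)%N by lia.
by rewrite !exprD; ring.
Qed.

Lemma off_tail_exponent :
  \sum_(1 <= i < e.+1) ((\sum_(i <= k < e.+1) f k + f e.+1) ^ 2)%N%:Z +
  \sum_(e.+1 <= j < d.+1) \sum_(e.+1 <= k < d.+1) (mbar l f j)%:Z * Cmat l j k * (f k)%:Z =
  (\sum_(1 <= i < e.+1) (\sum_(i <= k < e.+1) f k + f e.+1) ^ 2 + (f e.+1 ^ 2 + (step_nat e.+1 ^ 2 +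
   (\sum_(e.+2 <= j < d) step_nat j ^ 2 + f d * (f d.-1 - f d)))))%N%:Z.
Proof.
have sumPosz a b (g : nat -> nat) :
    \sum_(a <= i < b) (g i)%:Z = (\sum_(a <= i < b) g i)%N%:Z.
  by rewrite (big_morph Posz PoszD (erefl _)).
rewrite off_quad // sumPosz [\sum_(e.+1 <= j < d) _]big_ltn //.
rewrite (@eq_big_nat _ _ _ e.+2 d _ (fun j => (step_nat j ^ 2)%N%:Z)); last first.
  by move=> j h; rewrite step_natE; lia.
rewrite sumPosz step_natE; last by lia.
have fd : (f d <= f d.-1)%N by have := @supp d.-1; rewrite prednK; [apply; lia | lia].
have -> : (f d.-1)%:Z - (f d)%:Z = (f d.-1 - f d)%N%:Z by lia.
by rewrite !PoszD !PoszM; ring.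
Qed.

End OffsetFull.

Lemma off_term_full (R : realType) (q : R[i]) (l : seq nat) (e : nat) (s : seq nat) :
  (e.+1 < cf_d l)%N -> in_T l (cf_d l) -> size s = cf_d l ->
  off_term q l e (vec s) (vec s) = full_term q e (step_types l e.+1) s.
Proof.
move=> ed Td sd; rewrite full_termE; last by lia.
have e1 : (e < cf_d l)%N by lia.
rewrite (drop_vec sd e1) (drop_vec sd ed) step_typesS // [tail_term _ _ _]/=.
have [/allP supp|nsupp] := boolP (all (fun j => vec s j.+1 <= vec s j)%N (index_iota e.+1 (cf_d l))).
  have {}supp j : (e < j < cf_d l)%N -> (vec s j.+1 <= vec s j)%N.
    by move=> h; apply: supp; rewrite mem_index_iota.
  rewrite supp ?leqnn //.
  have := chain_termE q ed Td sd supp (p := e.+2); rewrite ltnS leqnn => /(_ ed) /= ->.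
  rewrite /off_term off_tail_exponent // -exprnP !exprD -/(step_nat l s e.+1).
  rewrite invfM; set P := \prod_(_ <= _ < _) _; set P' := \prod_(_ <= _ < _) _.
  rewrite -[qfac q (2 * _)]/(qf q (2 * vec s e.+1)).
  by ring.
rewrite [LHS](_ : _ = 0); last first.
  rewrite /off_term; apply/eqP; rewrite mulf_eq0; apply/orP; right; apply: contraR nsupp => nz.
  by apply/allP => j; rewrite mem_index_iota => h; apply: (off_support ed Td nz).
case: ifP => [fe|_]; last by rewrite !mulr0.
have [->|nz] := eqVneq (chain_term q (step_types l e.+2) (vec s e.+2) (vec s e.+1 - vec s e.+2) (drop e.+2 s)) 0.
  by rewrite !mulr0.
case/negP: nsupp; apply/allP => j; rewrite mem_index_iota => /andP[].
rewrite leq_eqVlt => /orP[/eqP <- //|ej] jd.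
by apply: (chain_term_support ed Td sd nz); rewrite ej.
Qed.

(** * The finite triple product *)

Section TripleProduct.
Variables (F : fieldType).

(** Homogeneous in u and v, so that u = p^N can centre the product without negative powers. *)
Lemma qbinomial_theorem (p u v : F) (M : nat) : (forall n, qf p n != 0) ->
  \prod_(i < M) (u - v * p ^+ i) =
  \sum_(k < M.+1) (-1) ^+ k * p ^+ tri (- k%:Z) * v ^+ k * u ^+ (M - k) * qb p M k.
Proof.
move=> pn0; elim: M => [|M IH].
  by rewrite big_ord0 big_ord1 qb0 // !mulr1 expr0.
pose f M k := (-1) ^+ k * p ^+ tri (- k%:Z) * v ^+ k * u ^+ (M - k) * qb p M k.
have fM : f M M.+1 = 0 by rewrite /f qb_small ?mulr0.
have -> : \sum_(k < M.+2) f M.+1 k =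
    u * \sum_(k < M.+1) f M k + \sum_(k < M.+1) - v * p ^+ M * f M k.
  have -> : u * \sum_(k < M.+1) f M k = u * \sum_(k < M.+2) f M k.
    by rewrite [in RHS]big_ord_recr /= fM addr0.
  rewrite [in RHS]big_ord_recl [in LHS]big_ord_recl mulrDr -addrA; congr (_ + _).
    by rewrite /f !subn0 !qb0 // !mulr1 exprS; ring.
  rewrite mulr_sumr -big_split /=; apply: eq_bigr => -[k /= kM] _; rewrite /f /bump /= add1n subSS.
  rewrite qbS // [(-1) ^+ k.+1]exprS [v ^+ k.+1]exprS.
  have T : tri (- k.+1%:Z) = (tri (- k%:Z) + k)%N.
    by have := triE (- k.+1%:Z); have := triE (- k%:Z); lia.
  rewrite T; have [kM'|kM'] := ltnP k M; last first.
    rewrite [qb p M k.+1]qb_small // (_ : k = M); last by lia.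
    by rewrite subnn expr0 exprD; ring.
  rewrite (_ : (M - k = (M - k.+1).+1)%N); last by lia.
  have -> : p ^+ M = p ^+ k * p ^+ (M - k.+1).+1 by rewrite -exprD; congr (_ ^+ _); lia.
  by rewrite !exprS exprD; ring.
by rewrite big_ord_recr /= IH -/(f M _) -mulr_sumr; ring.
Qed.

(** The q-binomial theorem in base p = q^(2c-1) with 2N factors, u = p^N and v = q^c: the terms k =
    N + n and k = N - n combine into [wt q c n], and the two halves of the product give the two
    factors. *)
Lemma triple_product (q : F) (c N : nat) : (1 < c)%N ->
  (forall n, qf (q ^+ (2 * c - 1)) n != 0) ->
  \sum_(n < N.+1) wt q c n * qb (q ^+ (2 * c - 1)) (2 * N) (N - n) =
  (\prod_(i < N) (1 - q ^+ (c - 1) * (q ^+ (2 * c - 1)) ^+ i)) *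
  (\prod_(i < N) (1 - q ^+ c * (q ^+ (2 * c - 1)) ^+ i)).
Proof.
move=> c1; set p := q ^+ (2 * c - 1) => pn0.
(* The general argument cancels a power of q, so q = 0 is settled directly. *)
have [q0|q0] := eqVneq q 0.
  have z n : (0 < n)%N -> q ^+ n = 0 by move=> h; rewrite q0 expr0n gtn_eqF.
  have p0 : p = 0 by rewrite /p z //; lia.
  have qf1 n : qf p n = 1 by rewrite /qf big1 // => i _; rewrite p0 mul0r subr0.
  rewrite [X in _ = X * _]big1 ?mul1r; last by move=> i _; rewrite z ?mul0r ?subr0 //; lia.
  rewrite [RHS]big1; last by move=> i _; rewrite z ?mul0r ?subr0 //; lia.
  have cn n : (tri n.+1 < c * n.+1 ^ 2)%N.
    by apply: leq_ltn_trans (tri_le _) _; rewrite ltn_Pmull.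
  rewrite big_ord_recl [X in _ + X]big1 ?addr0; last first.
    move=> i _; rewrite /bump /= /wt /= !z ?addr0 ?mulr0 ?mul0r //.
      by rewrite subn_gt0 (leq_ltn_trans (triN_le _)) ?cn.
    by rewrite subn_gt0 cn.
  by rewrite /wt /= mul1r /qb ifT ?qf1 ?mulr1 ?divr1 //; lia.
pose f k := (-1) ^+ k * p ^+ tri (- k%:Z) * (q ^+ c) ^+ k * (p ^+ N) ^+ (N.*2 - k) * qb p N.*2 k.
(* The middle term k = N of the expansion, without its binomial. *)
pose A := (-1) ^+ N * q ^+ (c * N + (2 * c - 1) * (tri (- N%:Z) + N ^ 2)).
have A0 : A != 0 by rewrite mulf_neq0 ?signr_eq0 ?expf_neq0.
apply: (mulfI A0).
have fE k : f k = (-1) ^+ k * q ^+ (c * k + (2 * c - 1) * (tri (- k%:Z) + N * (N.*2 - k))) * qb p N.*2 k.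
  by rewrite /f /p mulnDr !exprD -!exprM; ring.
transitivity (\sum_(k < N.*2.+1) f k).
  rewrite sum_ord_center big_ord_recl mulrDr; congr (_ + _).
    rewrite fE /wt /= mul1r subn0 mul2n /A; congr (_ * q ^+ (_ + _ * (_ + _)) * _).
    by rewrite -addnn addnK mulnn.
  rewrite mulr_sumr; apply: eq_bigr => -[n /= nN] _; rewrite /bump /= add1n !fE /A /wt /=.
  have -> : qb p N.*2 (N + n.+1) = qb p N.*2 (N - n.+1).
    by rewrite -[RHS]qb_sub; [congr (qb _ _ _); lia | lia].
  have T1 : tri (- (N + n.+1)%N%:Z) = (tri (- N%:Z) + tri (- n.+1%:Z) + N * n.+1)%N.
    by have := triE (- (N + n.+1)%N%:Z); have := triE (- N%:Z); have := triE (- n.+1%:Z); lia.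
  have T2 : (tri (- (N - n.+1)%N%:Z) + N * n.+1 = tri (- N%:Z) + tri n.+1)%N.
    by have := triE (- (N - n.+1)%N%:Z); have := triE (- N%:Z); have := triE n.+1; nia.
  have W1 : (c * n.+1 ^ 2 - tri (- n.+1%:Z) = (2 * c - 1) * tri (- n.+1%:Z) + c * n.+1)%N.
    have h : (2 * tri (- n.+1%:Z) + n.+1 = n.+1 ^ 2)%N by have := triE (- n.+1%:Z); lia.
    by rewrite -h mulnBl mulnDr; nia.
  have W2 : (c * n.+1 ^ 2 - tri n.+1 + c * n.+1 = (2 * c - 1) * tri n.+1)%N.
    have h : (2 * tri n.+1 = n.+1 ^ 2 + n.+1)%N by have := triE n.+1; lia.
    by have := tri_le n.+1; nia.
  have E1 : (c * (N + n.+1) + (2 * c - 1) * (tri (- (N + n.+1)%N%:Z) + N * (N.*2 - (N + n.+1))) =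
     c * N + (2 * c - 1) * (tri (- N%:Z) + N ^ 2) + (c * n.+1 ^ 2 - tri (- n.+1%:Z)))%N.
    rewrite W1 T1; have -> : (N.*2 - (N + n.+1) = N - n.+1)%N by lia.
    have -> : (tri (- N%:Z) + tri (- n.+1%:Z) + N * n.+1 + N * (N - n.+1) =
       tri (- N%:Z) + N ^ 2 + tri (- n.+1%:Z))%N by rewrite mulnBr; nia.
    by rewrite mulnDr [((2 * c - 1) * (_ + tri (- n.+1%:Z)))%N]mulnDr; lia.
  have E2 : (c * (N - n.+1) + (2 * c - 1) * (tri (- (N - n.+1)%N%:Z) + N * (N.*2 - (N - n.+1))) =
     c * N + (2 * c - 1) * (tri (- N%:Z) + N ^ 2) + (c * n.+1 ^ 2 - tri n.+1))%N.
    have -> : (N.*2 - (N - n.+1) = N + n.+1)%N by lia.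
    have -> : (tri (- (N - n.+1)%N%:Z) + N * (N + n.+1) = tri (- N%:Z) + N ^ 2 + tri n.+1)%N.
      by rewrite mulnDr -mulnn; lia.
    rewrite [((2 * c - 1) * (_ + tri n.+1))%N]mulnDr -W2.
    have : (c * (N - n.+1) + c * n.+1 = c * N)%N by rewrite -mulnDr subnK.
    by lia.
  rewrite E1 E2 !exprD [(2 * N)%N]mul2n (@sign_eq_odd _ (N - n.+1) (N + n.+1)); last by lia.
  by rewrite exprD; ring.
have cst (x : F) : x ^+ N = \prod_(i < N) x by rewrite prodr_const card_ord.
rewrite -[LHS](qbinomial_theorem (p ^+ N) (q ^+ c) N.*2 pn0) -addnn big_split_ord /=.
have -> : \prod_(i < N) (p ^+ N - q ^+ c * p ^+ (N + i)) =
    p ^+ (N * N) * \prod_(i < N) (1 - q ^+ c * p ^+ i).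
  rewrite exprM (cst (p ^+ N)) -big_split /=.
  by apply: eq_bigr => i _; rewrite exprD; ring.
have -> : \prod_(i < N) (p ^+ N - q ^+ c * p ^+ i) =
    (-1) ^+ N * q ^+ (c * N) * p ^+ tri (- N%:Z) * \prod_(i < N) (1 - q ^+ (c - 1) * p ^+ i).
  have prod_pX : \prod_(i < N) p ^+ i = p ^+ tri (- N%:Z).
    elim: (N) => [|n IH]; first by rewrite big_ord0.
    rewrite big_ord_recr /= IH -exprD; congr (_ ^+ _).
    by have := triE (- n.+1%:Z); have := triE (- n%:Z); lia.
  rewrite -prod_pX exprM (cst (-1)) (cst (q ^+ c)) [X in _ = _ * X](reindex_inj rev_ord_inj) /=.
  rewrite -!big_split; apply: eq_bigr => -[i /= iN] _.
  (* Since p = q^c q^(c-1), taking - q^c p^i out of the factor leaves 1 - q^(c-1) p^(N-1-i). *)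
  have -> : p ^+ N = q ^+ c * q ^+ (c - 1) * p ^+ i * p ^+ (N - i.+1).
    rewrite -exprD (_ : (c + (c - 1) = 2 * c - 1)%N) -/p; last by lia.
    by rewrite -exprS -exprD; congr (_ ^+ _); lia.
  by ring.
by rewrite /A /p !exprD -!exprM mulnDr exprD -mulnn !mulnA; ring.
Qed.

End TripleProduct.

(** * Continued fractions *)

(** Each quotient x gives x - 1 unmarked steps and then a marked one. The last mark is dropped: row
    d belongs to T, but there the chain stops at F_{1,1}. *)
Fixpoint cf_types (l : seq nat) : seq bool :=
  match l with
  | [::] => [::]
  | [:: x] => nseq x.-1 false
  | x :: l' => nseq x.-1 false ++ true :: cf_types l'
  end.

Lemma cf_t_cons (x : nat) (l : seq nat) (i : nat) : cf_t (x :: l) i.+1 = (x + cf_t l i)%N.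
Proof. by rewrite /cf_t big_ord_recl. Qed.

Lemma cf_d_cons (x : nat) (l : seq nat) : cf_d (x :: l) = (x + cf_d l)%N.
Proof. exact: cf_t_cons. Qed.

Lemma in_T_cons (x : nat) (l : seq nat) (j : nat) :
  in_T (x :: l) j = (x == j) || ((x <= j)%N && in_T l (j - x)).
Proof.
have t0 : cf_t l 0 = 0%N by rewrite /cf_t big_ord0.
rewrite /in_T /= cf_t_cons t0 addn0; congr (_ || _).
rewrite (iotaDl 1 1) has_map; case: leqP => xj /=.
  by apply: eq_has => i /=; rewrite add1n cf_t_cons; apply/eqP/eqP; lia.
by apply/hasPn => i _ /=; rewrite add1n cf_t_cons; apply/eqP; lia.
Qed.

Lemma in_T_cf_d (l : seq nat) : l != [::] -> in_T l (cf_d l).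
Proof.
move=> l0; apply/hasP; exists (size l) => //.
by rewrite mem_iota add1n ltnS leqnn andbT; case: (l) l0.
Qed.

Lemma last_le_cf_d (l : seq nat) : (last 0 l <= cf_d l)%N.
Proof.
suff H y : (last y l <= y + cf_d l)%N by have := H 0%N.
elim: l y => [|x l IH] y /=; first by rewrite leq_addr.
by rewrite cf_d_cons; have := IH x; lia.
Qed.

(** For a > 2b the rows of the first quotient are replaced by Bailey steps, and the chain is that of
    the remaining quotients. *)
Lemma step_types_behead (x : nat) (l : seq nat) : (0 < x)%N ->
  step_types (x :: l) x.+1 = step_types l 1.
Proof.
move=> x0; rewrite /step_types cf_d_cons (_ : (x + _ - x.+1 = cf_d l - 1)%N); last by lia.
rewrite -[x.+1]addn1 iotaDl -map_comp; apply/eq_in_map => j; rewrite mem_iota => /andP[j1 _] /=.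
by rewrite in_T_cons leq_addr addKn (_ : (x == x + j)%N = false) //; apply/eqP; lia.
Qed.

Lemma map_in_T_small (x : nat) (l : seq nat) :
  [seq in_T (x :: l) j | j <- iota 1 x.-1] = nseq x.-1 false.
Proof.
have -> : nseq x.-1 false = map (fun=> false) (iota 1 x.-1).
  by elim: x.-1 1%N => // n IH k /=; rewrite -IH.
apply/eq_in_map => j; rewrite mem_iota in_T_cons => h.
by apply/negbTE/negP => /orP[/eqP|/andP[]]; lia.
Qed.

Lemma step_types_cf (l : seq nat) : all (fun x => 0 < x)%N l -> step_types l 1 = cf_types l.
Proof.
elim: l => [|x [|y l] IH]; first by rewrite /step_types /cf_d /cf_t big_ord0.
  rewrite /= andbT => x0; rewrite /step_types cf_d_cons /cf_d /cf_t big_ord0 addn0 subn1.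
  exact: map_in_T_small.
move=> /andP[x0 l0]; rewrite [cf_types [:: x, y & l]]/= -/(cf_types (y :: l)) -IH // -(@step_types_behead x (y :: l) x0) /step_types.
have -> : (cf_d [:: x, y & l] - 1 = x.-1 + (cf_d [:: x, y & l] - x.+1).+1)%N.
  by rewrite !cf_d_cons; move: l0 => /andP[]; lia.
rewrite iotaD map_cat /=; congr (_ ++ _).
  exact: map_in_T_small.
by rewrite add1n prednK // in_T_cons eqxx.
Qed.

Lemma burge_pair_nseq (k : nat) (ts : seq bool) :
  burge_pair (nseq k false ++ ts) =
  ((burge_pair ts).1 + k * (burge_pair ts).2, (burge_pair ts).2)%N.
Proof.
elim: k => [|k IH] /=; first by rewrite mul0n addn0; case: burge_pair.
by rewrite IH mulSn; congr (_, _); lia.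
Qed.

(** On the ratio r of the slopes an unmarked step is r -> r + 1 and a marked one is r -> 1 + 1/r, so
    a block for x is r -> x + 1/r. The start at ratio 1 accounts for the x - 1 steps of the last
    quotient. *)
Lemma cfval_burge_pair (l : seq nat) : l != [::] -> all (fun x => 0 < x)%N l ->
  coprime (burge_pair (cf_types l)).1 (burge_pair (cf_types l)).2 /\
  cfval l = (burge_pair (cf_types l)).1%:R / (burge_pair (cf_types l)).2%:R.
Proof.
elim: l => // x [|y l] IH _ /andP[x0 l0].
  rewrite [cf_types _]/= -[nseq _ _]cats0 burge_pair_nseq /= muln1 add1n prednK // divr1.
  by rewrite coprimen1.
have [] := IH isT l0.
rewrite [cf_types [:: x, y & l]]/= -/(cf_types (y :: l)) burge_pair_nseq.
have := burge_pair_gt0 (cf_types (y :: l)).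
rewrite [burge_pair (true :: _)]/=; case: burge_pair => u v /= /andP[u0 v0] uv E.
have -> : (u + v + x.-1 * u = x * u + v)%N by case: x x0 => // x _; rewrite mulSn; lia.
split; first by rewrite coprime_sym /coprime gcdnMDl.
rewrite /= E invf_div natrD natrM mulrDl mulfK //.
by rewrite pnatr_eq0 -lt0n.
Qed.

Lemma coprime_frac_eq (u v x y : nat) : coprime u v -> coprime x y -> (0 < u)%N ->
  (u * y = x * v)%N -> u = x /\ v = y.
Proof.
move=> uv xy u0 E.
have ux : u = x.
  apply/eqP; rewrite eqn_dvd; apply/andP; split.
    by rewrite -(Gauss_dvdl x uv) -E dvdn_mulr.
  by rewrite -(Gauss_dvdl u xy) E dvdn_mulr.
split=> //; move: E; rewrite -ux => /eqP; rewrite eqn_pmul2l // => /eqP.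
by [].
Qed.

Lemma cf_burge_pair_lt (a b : nat) (l : seq nat) :
  coprime a b -> (b < a)%N -> (a < 2 * b)%N -> is_cf_expansion a b l ->
  burge_pair (step_types l 1) = (b, a - b)%N.
Proof.
move=> ab ba a2b [l0 lpos _ lE]; rewrite step_types_cf //.
have [] := cfval_burge_pair l0 lpos; have := burge_pair_gt0 (cf_types l).
case: burge_pair => u v /= /andP[u0 v0] uv.
rewrite lE /cf_target ifF; last by lia.
have b0 : b%:R != 0 :> rat by rewrite pnatr_eq0; lia.
have ab0 : a%:R - b%:R != 0 :> rat by rewrite subr_eq0 eqr_nat; lia.
have vn0 : v%:R != 0 :> rat by rewrite pnatr_eq0; lia.
have -> : (a%:R / b%:R - 1)^-1 = b%:R / (a%:R - b%:R) :> rat by field; rewrite b0 ab0.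
move/eqP; rewrite eqr_div // -natrB 1?ltnW // -!natrM eqr_nat => /eqP E.
have bab : coprime b (a - b) by move: ab; rewrite -{1}(subnK (ltnW ba)) coprime_sym /coprime gcdnDr.
by have [-> ->] := coprime_frac_eq uv bab u0 (esym E).
Qed.

(** If the tail of the expansion is u/v, then (a-b)/b = (x u + v)/u in lowest terms, so u = b and v
    = a - (x+1)b. An expansion of length one would make (a-b)/b an integer, against b > 1. *)
Lemma cf_burge_pair_gt (a b : nat) (l : seq nat) :
  coprime a b -> (1 < b)%N -> (2 * b < a)%N -> is_cf_expansion a b l ->
  [/\ ((cf_a0 l).+1 < cf_d l)%N, ((cf_a0 l).+1 * b < a)%N &
    burge_pair (step_types l (cf_a0 l).+1) = (b, a - (cf_a0 l).+1 * b)%N].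
Proof.
move=> ab b1 a2b [l0 lpos llast lE].
have bn0 : b%:R != 0 :> rat by rewrite pnatr_eq0; lia.
have bab : coprime (a - b) b.
  have ba : (b <= a)%N by lia.
  by rewrite coprime_sym; move: ab; rewrite -{1}(subnK ba) coprime_sym /coprime gcdnDr.
move: lE; rewrite /cf_target a2b.
have -> : a%:R / b%:R - 1 = (a - b)%N%:R / b%:R :> rat.
  by rewrite natrB ?mulrBl ?divff //; lia.
case: l l0 lpos llast => // x [|y l] _ /andP[x0 lpos] llast.
  move=> /= /eqP; rewrite -[x%:R]divr1 eqr_div ?oner_eq0 // mulr1 -natrM eqr_nat => /eqP E.
  have [_ b1'] := coprime_frac_eq (coprimen1 x) bab x0 (etrans E (esym (muln1 _))).
  by rewrite -b1' in b1.
rewrite [cfval _]/= -/(cfval (y :: l)) [cf_a0 _]/= => E.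
rewrite step_types_behead // step_types_cf //.
have [] := cfval_burge_pair (isT : y :: l != [::]) lpos; have := burge_pair_gt0 (cf_types (y :: l)).
case: burge_pair => u v /= /andP[u0 v0] uv E'.
have un0 : u%:R != 0 :> rat by rewrite pnatr_eq0; lia.
move: E => /=; rewrite E' invf_div.
have -> : x%:R + v%:R / u%:R = (x * u + v)%N%:R / u%:R :> rat by rewrite natrD natrM mulrDl mulfK.
move/eqP; rewrite eqr_div // -!natrM eqr_nat => /eqP E.
have uvx : coprime (x * u + v) u by rewrite coprime_sym /coprime gcdnMDl.
have xuv0 : (0 < x * u + v)%N by rewrite addn_gt0 v0 orbT.
have [F1 F2] := coprime_frac_eq uvx bab xuv0 E.
have := last_le_cf_d (y :: l); rewrite (cf_d_cons x (y :: l)).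
rewrite /= in llast *; move: F1; rewrite F2 (_ : cf_a0 _ = x) // mulSn => F1 H.
by split; [lia | lia | congr (_, _); lia].
Qed.

(** * Limits *)

Section ComplexSequences.
Local Open Scope classical_set_scope.
Variable R : realType.
Local Notation C := R[i].
Implicit Types (u v : nat -> C) (a b : C).

Lemma cvgCP u a :
  u @ \oo --> a <-> forall eps, 0 < eps -> exists N, forall n, (N <= n)%N -> `|a - u n| < eps.
Proof.
split=> [/(@cvgrPdist_lt C C^o) H eps e0|H].
  by have [N _ HN] := H eps e0; exists N.
by apply/(@cvgrPdist_lt C C^o) => eps e0; have [N HN] := H eps e0; exists N.
Qed.

Lemma cvgC_lim u a : u @ \oo --> a -> lim (u @ \oo) = a.
Proof. by move=> ua; apply: (@cvg_lim C^o) => //; apply: norm_hausdorff. Qed.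

Lemma cvgCM u v a b : u @ \oo --> a -> v @ \oo --> b -> (fun n => u n * v n) @ \oo --> a * b.
Proof. by move=> ua vb; exact: (@cvgM C nat (nbhs \oo) _ u v a b ua vb). Qed.

Lemma cvgCD u v a b : u @ \oo --> a -> v @ \oo --> b -> (fun n => u n + v n) @ \oo --> a + b.
Proof. by move=> ua vb; exact: (@cvgD C C^o nat (nbhs \oo) _ u v a b ua vb). Qed.

Lemma cvgC_cst a : (fun=> a) @ \oo --> a.
Proof. exact: (@cvg_cst C^o). Qed.

Lemma cvgCV u a : a != 0 -> u @ \oo --> a -> (fun n => (u n)^-1) @ \oo --> a^-1.
Proof. by move=> a0 ua; exact: (@cvgV C nat (nbhs \oo) _ u a a0 ua). Qed.

Lemma cvgC_near (k : nat) u v a :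
  (forall n, (k <= n)%N -> u n = v n) -> u @ \oo --> a -> v @ \oo --> a.
Proof.
move=> uv /cvgCP ua; apply/cvgCP => eps e0; have [N HN] := ua eps e0.
by exists (maxn k N) => n; rewrite geq_max => /andP[kn Nn]; rewrite -uv // HN.
Qed.

Lemma cvgC_sub (phi : nat -> nat) (k : nat) u a :
  (forall n, (n <= phi n + k)%N) -> u @ \oo --> a -> (u \o phi) @ \oo --> a.
Proof.
move=> phik /cvgCP ua; apply/cvgCP => eps e0; have [N HN] := ua eps e0.
by exists (N + k)%N => n Nn; apply: HN; have := phik n; lia.
Qed.

Lemma cvgC_sum (k : nat) (g : nat -> nat -> C) :
  (forall i, (i < k)%N -> g^~ i @ \oo --> (0 : C)) ->
  (fun n => \sum_(i < k) g n i) @ \oo --> (0 : C).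
Proof.
elim: k => [|k IH] g0.
  by apply: (@cvgC_near 0 (fun=> 0)); [move=> n _; rewrite big_ord0 | exact: cvgC_cst].
have H1 := IH (fun i h => g0 i (ltnW h)); have H2 := g0 k (ltnSn k).
have := cvgCD H1 H2; rewrite addr0; apply: (@cvgC_near 0) => n _.
by rewrite big_ord_recr.
Qed.

Lemma real_of_ge0 a : 0 <= a -> a = (complex.Re a)%:C%C /\ 0 <= complex.Re a.
Proof. by case: a => x y; rewrite lecE /= => /andP[/eqP -> ->]. Qed.

Lemma expr_small (rho eps : C) : 0 <= rho < 1 -> 0 < eps ->
  exists N, forall n, (N <= n)%N -> rho ^+ n < eps.
Proof.
move=> /andP[rho0 rho1] eps0; have [rhoE r0] := real_of_ge0 rho0.
have [epsE _] := real_of_ge0 (ltW eps0).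
have r1 : `|complex.Re rho| < 1 by rewrite ger0_norm //; move: rho1; rewrite {1}rhoE ltcR.
have e0 : 0 < complex.Re eps by move: eps0; rewrite {1}epsE ltcR.
have /cvgrPdist_lt /(_ _ e0) [N _ HN] := cvg_expr r1.
exists N => n Nn; have := HN n Nn; rewrite sub0r normrN ger0_norm ?exprn_ge0 // => H.
by rewrite rhoE epsE -rmorphXn ltcR.
Qed.

Lemma geometric_tail (rho : C) (k n : nat) : 0 <= rho < 1 ->
  \sum_(k <= i < n) rho ^+ i <= rho ^+ k / (1 - rho).
Proof.
move=> /andP[rho0 rho1]; have h : 0 < 1 - rho by rewrite subr_gt0.
rewrite ler_pdivlMr //; have [kn|nk] := leqP k n; last first.
  by rewrite big_geq ?mul0r ?exprn_ge0 // ltnW.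
rewrite mulr_suml (eq_bigr (fun i => - (rho ^+ i.+1 - rho ^+ i))); last first.
  by move=> i _; rewrite exprS; ring.
by rewrite sumrN telescope_sumr // opprB lerBlDr lerDl exprn_ge0.
Qed.

(* Dominated convergence for sums whose range grows with [n]. *)
Lemma tannery (rho c : C) (g : nat -> nat -> C) : 0 <= rho < 1 ->
  (forall n k, (k <= n)%N -> `|g n k| <= c * rho ^+ k) ->
  (forall k, g^~ k @ \oo --> (0 : C)) ->
  (fun n => \sum_(k < n.+1) g n k) @ \oo --> (0 : C).
Proof.
move=> rho01 gb g0; have /andP[rho0 rho1] := rho01.
have c0 : 0 <= c by have := gb 0%N 0%N isT; rewrite expr0 mulr1; apply: le_trans.
have h : 0 < 1 - rho by rewrite subr_gt0.
apply/cvgCP => eps e0.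
have [k Hk] : exists k, c * (rho ^+ k / (1 - rho)) < eps / 2.
  (* Dividing by c + 1 also covers c = 0. *)
  have e' : 0 < eps / 2 * (1 - rho) / (c + 1) 
    by apply: divr_gt0; [apply: mulr_gt0 => //; exact: divr_gt0 | rewrite ltr_wpDl].
  have [k /(_ k (leqnn k)) Hk] := expr_small rho01 e'; exists k.
  rewrite mulrA ltr_pdivrMr //; rewrite ltr_pdivlMr ?ltr_wpDl // in Hk.
  by apply: le_lt_trans Hk; rewrite mulrDr mulr1 mulrC lerDl exprn_ge0.
have /cvgCP /(_ (eps / 2)) [|N HN] := @cvgC_sum k g (fun i _ => g0 i); first by rewrite divr_gt0.
exists (maxn N k) => n; rewrite geq_max => /andP[Nn kn].
rewrite -(big_mkord xpredT (g n)) (@big_cat_nat _ _ _ k) //= ?leqW // big_mkord.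
rewrite opprD addrA [eps](splitr eps); apply: le_lt_trans (ler_normB _ _) _.
apply: ltrD; first exact: HN.
apply: le_lt_trans Hk; apply: le_trans (ler_norm_sum _ _ _) _.
apply: (@le_trans _ _ (\sum_(k <= i < n.+1) c * rho ^+ i)).
  by apply: ler_sum_nat => i /andP[_ ilt]; apply: gb.
by rewrite -mulr_sumr ler_wpM2l // geometric_tail.
Qed.

Lemma prod_1D_geometric_le (c r : R) (n : nat) : 0 <= c -> 0 <= r < 1 ->
  \prod_(i < n) (1 + c * r ^+ i) <= expR (c / (1 - r)).
Proof.
move=> c0 /andP[r0 r1].
apply: (@le_trans _ _ (expR (c * \sum_(i < n) r ^+ i))).
  rewrite mulr_sumr; elim: n => [|n IH]; first by rewrite !big_ord0 expR0.
  rewrite !big_ord_recr /= expRD; apply: ler_pM => //.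
    by apply: prodr_ge0 => i _; rewrite addr_ge0 ?mulr_ge0 ?exprn_ge0.
    by rewrite addr_ge0 ?mulr_ge0 ?exprn_ge0.
  exact: expR_ge1Dx.
rewrite ler_expR ler_wpM2l // -[leRHS]mul1r ler_pdivlMr ?subr_gt0 //.
by rewrite mulrC -opprB mulNr -subrX1 opprB lerBlDr lerDl exprn_ge0.
Qed.

Lemma prod_1D_geometric_bounded (c rho : C) : 0 <= c -> 0 <= rho < 1 ->
  exists K : C, forall n, \prod_(i < n) (1 + c * rho ^+ i) <= K.
Proof.
move=> c0 /andP[rho0 rho1]; have [-> r0] := real_of_ge0 c0; have [rhoE r0'] := real_of_ge0 rho0.
exists (expR (complex.Re c / (1 - complex.Re rho)))%:C%C => n.
rewrite rhoE; under eq_bigr => i _ do rewrite -rmorphXn -rmorphM -[1](rmorph1 (@real_complex R)) -rmorphD.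
rewrite -rmorph_prod lecR; apply: prod_1D_geometric_le => //.
by rewrite r0' /=; move: rho1; rewrite {1}rhoE ltcR.
Qed.

Lemma qpoch_bounded (x q : C) : `|q| < 1 -> exists K, forall n, `|qpoch x q n| <= K.
Proof.
move=> q1; have [|K HK] := @prod_1D_geometric_bounded `|x| `|q| (normr_ge0 _).
  by rewrite normr_ge0.
exists K => n; apply: le_trans (HK n); rewrite /qpoch normr_prod.
apply: ler_prod => i _; rewrite normr_ge0 /=; apply: le_trans (ler_normB _ _) _.
by rewrite normr1 normrM normrX.
Qed.

(** For 0 <= t <= s < 1 one has 1/(1-t) <= 1 + t/(1-s). With s = |q| and t = s^(i+1), this bounds
    the inverse by a product with constant s/(1-s). *)
Lemma qfV_bounded (q : C) : `|q| < 1 -> exists K, forall n, `|(qf q n)^-1| <= K.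
Proof.
move=> q1; have q0 := normr_ge0 q; have h : 0 < 1 - `|q| by rewrite subr_gt0.
have [||K HK] := @prod_1D_geometric_bounded (`|q| / (1 - `|q|)) `|q|.
- by rewrite divr_ge0 // ltW.
- by rewrite q0.
exists K => n; apply: le_trans (norm_qfV q1 n) _; apply: le_trans (HK n).
rewrite /qf -prodfV; apply: ler_prod => i _.
have t1 : `|q| ^+ i.+1 <= `|q| by rewrite exprS ler_piMr // exprn_ile1 // ltW.
have h' : 0 < 1 - `|q| ^+ i.+1 by rewrite subr_gt0 (le_lt_trans t1).
rewrite -exprS invr_ge0 ltW //= -[leLHS]mul1r ler_pdivrMr // mulrAC -exprS.
rewrite -subr_ge0; set t := `|q| ^+ i.+1; set s := `|q|.
have -> : (1 + t / (1 - s)) * (1 - t) - 1 = t * (s - t) / (1 - s).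
  by field; rewrite gt_eqF.
by rewrite divr_ge0 ?mulr_ge0 ?subr_ge0 ?exprn_ge0 // ltW.
Qed.

Lemma normC_le_ReIm (z : C) : `|z| <= `|complex.Re z|%:C%C + `|complex.Im z|%:C%C.
Proof.
have nR (r : R) : `|r%:C%C| = `|r|%:C%C by rewrite normc_def /= expr0n addr0 sqrtr_sqr.
rewrite {1}[z]complexE; apply: le_trans (ler_normD _ _) _; rewrite normrM !nR lerD //.
by rewrite normc_def /= expr0n expr1n add0r sqrtr1 mul1r.
Qed.

(** Completeness is taken from the reals: the increments of the real and imaginary parts are
    dominated by the same geometric series. *)
Lemma cvgC_complete (rho c : C) u : 0 <= rho < 1 ->
  (forall n, `|u n.+1 - u n| <= c * rho ^+ n) -> exists a, u @ \oo --> a.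
Proof.
move=> /andP[rho0 rho1] ub.
have c0 : 0 <= c by have := ub 0%N; rewrite expr0 mulr1; apply: le_trans.
have [cE c0'] := real_of_ge0 c0; have [rhoE r0] := real_of_ge0 rho0.
have r1 : `|complex.Re rho| < 1 by rewrite ger0_norm //; move: rho1; rewrite {1}rhoE ltcR.
have real_part (v : nat -> R) :
    (forall n, (`|v n.+1 - v n|)%:C%C <= `|u n.+1 - u n|) -> cvgn v.
  move=> vb; rewrite (_ : v = (fun n => v 0%N + series (telescope v) n)); last first.
    by apply/funext => n; exact: eq_sum_telescope.
  apply: is_cvgD; first exact: is_cvg_cst.
  apply: normed_cvg.
  apply: (series_le_cvg _ _ _ (@is_cvg_geometric_series R (complex.Re c) _ r1)) => n //=.
    by rewrite mulr_ge0 // exprn_ge0.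
  have := le_trans (vb n) (ub n); rewrite cE rhoE -rmorphXn -rmorphM lecR.
  by rewrite /telescope.
have /real_part /cvg_ex[/= a Ha] n :
    (`|complex.Re (u n.+1) - complex.Re (u n)|)%:C%C <= `|u n.+1 - u n|.
  by rewrite -raddfB normc_ge_Re.
have /real_part /cvg_ex[/= b Hb] n :
    (`|complex.Im (u n.+1) - complex.Im (u n)|)%:C%C <= `|u n.+1 - u n|.
  by rewrite -raddfB normc_def lecR -sqrtr_sqr ler_wsqrtr // lerDr sqr_ge0.
exists (a +i* b)%C; apply/cvgCP => eps e0.
have [epsE _] := real_of_ge0 (ltW e0).
have e0' : 0 < complex.Re eps / 2 by move: e0; rewrite {1}epsE ltcR => h; rewrite divr_gt0.
move/cvgrPdist_lt: Ha => /(_ _ e0') [N1 _ H1]; move/cvgrPdist_lt: Hb => /(_ _ e0') [N2 _ H2].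
exists (maxn N1 N2) => n; rewrite geq_max => /andP[/H1 {}H1 /H2 {}H2].
rewrite epsE [complex.Re eps]splitr rmorphD /=.
apply: le_lt_trans (normC_le_ReIm _) _; rewrite !raddfB /=.
by apply: ltrD; rewrite ltcR.
Qed.

End ComplexSequences.

(** * Infinite products and the passage to infinite size *)

Section Limit.
Local Open Scope classical_set_scope.
Variable R : realType.
Local Notation C := R[i].

Lemma qpoch_cvg (x q : C) : `|q| < 1 -> qpoch x q @ \oo --> qpoch_inf x q.
Proof.
move=> q1; have [K HK] := qpoch_bounded x q1.
have K0 : 0 <= K by apply: le_trans (HK 0%N).
have [||a Ha] := @cvgC_complete R `|q| (K * `|x|) (qpoch x q); first by rewrite normr_ge0.
  move=> n; rewrite /qpoch big_ord_recr /= -/(qpoch x q n).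
  have -> : qpoch x q n * (1 - x * q ^+ n) - qpoch x q n = - (qpoch x q n * x * q ^+ n) by ring.
  rewrite normrN !normrM normrX ler_wpM2r ?exprn_ge0 // ler_wpM2r //.
by rewrite /qpoch_inf (cvgC_lim Ha).
Qed.

Lemma qf_cvg (q : C) : `|q| < 1 -> qf q @ \oo --> qpoch_inf q q.
Proof. exact: qpoch_cvg. Qed.

(** The inverses of the partial products stay bounded, so the products cannot tend to 0. *)
Lemma qpoch_inf_neq0 (q : C) : `|q| < 1 -> qpoch_inf q q != 0.
Proof.
move=> q1; have [K HK] := qfV_bounded q1; apply/eqP => Q0.
have K0 : 0 < K by apply: lt_le_trans (HK 0%N); rewrite normr_gt0 invr_eq0 qf_neq0_lt1.
have /cvgCP /(_ K^-1) [|N /(_ N (leqnn N))] := qf_cvg q1; first by rewrite invr_gt0.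
rewrite Q0 sub0r normrN => H; have := HK N; rewrite normfV => H'.
have qN : 0 < `|qf q N| by rewrite normr_gt0 qf_neq0_lt1.
have : K < `|qf q N|^-1 by rewrite -[ltLHS]invrK ltf_pV2 ?posrE ?invr_gt0.
by move/lt_le_trans => /(_ _ H'); rewrite ltxx.
Qed.

Lemma qf_bounded (q : C) : `|q| < 1 ->
  exists2 K, 0 <= K & forall n, `|qf q n| <= K /\ `|(qf q n)^-1| <= K.
Proof.
move=> q1; have [K1 H1] := qpoch_bounded q q1; have [K2 H2] := qfV_bounded q1.
have K10 : 0 <= K1 by apply: le_trans (H1 0%N).
have K20 : 0 <= K2 by apply: le_trans (H2 0%N).
exists (K1 + K2); first exact: addr_ge0.
by move=> n; split; [apply: le_trans (H1 n) _ | apply: le_trans (H2 n) _]; rewrite ?lerDl ?lerDr.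
Qed.

Lemma qb_bounded (q : C) : `|q| < 1 -> exists2 K, 0 <= K & forall n k, `|qb q n k| <= K.
Proof.
move=> q1; have [K K0 HK] := qf_bounded q1.
exists (K * (K * K)); first by rewrite !mulr_ge0.
move=> n k; rewrite /qb; case: ifP => _; last by rewrite normr0 !mulr_ge0.
rewrite normrM invfM normrM; apply: ler_pM; rewrite ?mulr_ge0 //; first exact: (HK _).1.
by apply: ler_pM => //; exact: (HK _).2.
Qed.

(** For c >= 2 both exponents are at least 2n^2 - n(n+1)/2 >= n; the factor 2 counts the two
    powers. *)
Lemma norm_wt (q : C) (c n : nat) : `|q| < 1 -> (1 < c)%N -> `|wt q c n| <= 2 * `|q| ^+ n.
Proof.
move=> q1 c1; rewrite /wt; case: eqP => [->|_]; first by rewrite normr1 expr0 mulr1 ler1n.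
have le_exp (e : nat) : (e <= tri n)%N -> `|q ^+ (c * n ^ 2 - e)| <= `|q| ^+ n.
  move=> en; rewrite normrX; apply: ler_wiXn2l; rewrite ?normr_ge0 ?ltW //.
  have h : (2 * tri n = n ^ 2 + n)%N by have := triE n; lia.
  have : (2 * n ^ 2 <= c * n ^ 2)%N by rewrite leq_mul2r c1 orbT.
  have : (n <= n ^ 2)%N by case: (n) => // m; rewrite -mulnn leq_pmull.
  lia.
rewrite normrM normrX normrN1 expr1n mul1r mulr_natl mulr2n.
by apply: le_trans (ler_normD _ _) _; rewrite lerD ?le_exp ?triN_le.
Qed.

Lemma bailey_sum_bounded (q : C) (c b : nat) : `|q| < 1 -> (1 < c)%N ->
  exists2 K, 0 <= K & forall m, `|bailey_sum q c b m| <= K.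
Proof.
move=> q1 c1; have [K K0 HK] := qf_bounded q1.
have h : 0 < 1 - `|q| by rewrite subr_gt0.
exists (2 * (K * K) * (`|q| ^+ 0 / (1 - `|q|))).
  by rewrite !mulr_ge0 ?invr_ge0 // ltW.
move=> m; apply: le_trans (ler_norm_sum _ _ _) _.
apply: (@le_trans _ _ (\sum_(n < m.+1) 2 * (K * K) * `|q| ^+ n)).
  apply: ler_sum => n _; rewrite normrM mulrAC; apply: ler_pM => //; first exact: norm_wt.
  rewrite /cc; case: ifP => _; last by rewrite normr0 mulr_ge0.
  by rewrite invfM normrM; apply: ler_pM => //; exact: (HK _).2.
rewrite -mulr_sumr -(big_mkord xpredT (fun n => `|q| ^+ n)) ler_wpM2l ?mulr_ge0 //.
by rewrite geometric_tail // normr_ge0.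
Qed.

(** The Bailey step with N = oo: after multiplication by (q)_N its weights (q)_N/(q)_(N-m) tend to
    1. A difference is stated because the limit of its second term is found separately. *)
Lemma cvg_bailey_sum (q : C) (c b : nat) : `|q| < 1 -> (1 < c)%N -> (0 < b)%N ->
  (fun N => \sum_(m < N.+1) q ^+ (m ^ 2) * bailey_sum q c b m -
     qf q N * bailey_sum q (c + b ^ 2) b N) @ \oo --> (0 : C).
Proof.
move=> q1 c1 b0; have qn0 := qf_neq0_lt1 q1; have Q0 := qpoch_inf_neq0 q1.
have [K K0 HK] := qf_bounded q1; have [B B0 HB] := bailey_sum_bounded b q1 c1.
pose g N m := q ^+ (m ^ 2) * bailey_sum q c b m * (1 - qf q N * (qf q (N - m))^-1).
apply: (@cvgC_near _ 0 (fun N => \sum_(m < N.+1) g N m)).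
  move=> N _; rewrite -(bailey_sum_step qn0 N (ltnW c1) b0) mulr_sumr -sumrB.
  by apply: eq_bigr => m _; rewrite /g; ring.
apply: (@tannery _ `|q| (B * (1 + K * K))); first by rewrite normr_ge0.
  move=> N m _; rewrite /g normrM [leRHS]mulrAC; apply: ler_pM => //.
    rewrite normrM mulrC; apply: ler_pM => //.
    rewrite normrX; apply: ler_wiXn2l; rewrite ?normr_ge0 ?ltW //.
    by case: (m) => // k; rewrite -mulnn leq_pmull.
  apply: le_trans (ler_normB _ _) _; rewrite normr1 lerD2l normrM.
  by apply: ler_pM => //; [exact: (HK _).1 | exact: (HK _).2].
move=> m; rewrite /g.
have S : (fun N => (qf q (N - m))^-1) @ \oo --> (qpoch_inf q q)^-1.
  apply: cvgCV => //; apply: (@cvgC_sub _ (fun N => (N - m)%N) m); last exact: qf_cvg.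
  by move=> n; lia.
move: (q ^+ (m ^ 2) * bailey_sum q c b m) => A.
have := cvgCD (@cvgC_cst R A) (cvgCM (@cvgC_cst R (- A)) (cvgCM (qf_cvg q1) S)).
have -> : A + - A * (qpoch_inf q q * (qpoch_inf q q)^-1) = 0.
  by rewrite (mulfV Q0) mulr1 subrr.
by apply: (@cvgC_near _ 0) => n _; rewrite mulNr mulrBr mulr1.
Qed.

(** For fixed n the kernel (q)_N [cc] tends to 1/(q)_oo whatever b is, and the binomial of the
    triple product tends to 1/(p;p)_oo. After scaling by L the two sums differ by terms tending to
    0, under a common geometric bound. *)
Lemma cvg_theta (q : C) (c b : nat) : `|q| < 1 -> (1 < c)%N ->
  let p := q ^+ (2 * c - 1) in
  (fun N => qf q N * bailey_sum q c b N) @ \oo -->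
  qpoch_inf (q ^+ (c - 1)) p * qpoch_inf (q ^+ c) p * qpoch_inf p p / qpoch_inf q q.
Proof.
move=> q1 c1 p; have p1 : `|p| < 1.
  by rewrite normrX exprn_ilt1 ?normr_ge0 //; lia.
have qn0 := qf_neq0_lt1 q1; have Q0 := qpoch_inf_neq0 q1.
have pn0 := qf_neq0_lt1 p1; have P0 := qpoch_inf_neq0 p1.
pose L := qpoch_inf p p / qpoch_inf q q.
have J : (fun N => \sum_(n < N.+1) wt q c n * qb p (2 * N) (N - n) * L) @ \oo -->
    qpoch_inf (q ^+ (c - 1)) p * qpoch_inf (q ^+ c) p * L.
  apply: (@cvgC_near _ 0 (fun N => qpoch (q ^+ (c - 1)) p N * qpoch (q ^+ c) p N * L)).
    by move=> N _; rewrite -mulr_suml triple_product.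
  by apply: cvgCM (@cvgC_cst R L); apply: cvgCM; apply: qpoch_cvg.
pose g N n := wt q c n * (qf q N * cc q N (b * n) - qb p (2 * N) (N - n) * L).
rewrite -mulrA -/L -[X in _ --> X]add0r.
apply: (@cvgC_near _ 0 (fun N => \sum_(n < N.+1) g N n +
    \sum_(n < N.+1) wt q c n * qb p (2 * N) (N - n) * L)).
  move=> N _; rewrite mulr_sumr -big_split; apply: eq_bigr => n _ /=; rewrite /g; ring.
apply: cvgCD J; have [K K0 HK] := qf_bounded q1; have [K' K0' HK'] := qb_bounded p1.
apply: (@tannery _ `|q| (2 * (K * (K * K) + K' * `|L|))); first by rewrite normr_ge0.
  move=> N n _; rewrite /g normrM [leRHS]mulrAC; apply: ler_pM => //; first exact: norm_wt.
  apply: le_trans (ler_normB _ _) _; apply: lerD; rewrite normrM; apply: ler_pM => //.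
    exact: (HK _).1.
  rewrite /cc; case: ifP => _; last by rewrite normr0 mulr_ge0.
  by rewrite invfM normrM; apply: ler_pM => //; exact: (HK _).2.
have leq_subD k m : (m <= (m - k) + k)%N by lia.
have leq_addD0 k m : (m <= (m + k) + 0)%N by lia.
move=> n; have sub (r : C) (phi : nat -> nat) k : `|r| < 1 -> (forall m, (m <= phi m + k)%N) ->
    (fun N => (qf r (phi N))^-1) @ \oo --> (qpoch_inf r r)^-1.
  move=> r1 phik; apply: cvgCV; first exact: qpoch_inf_neq0.
  by apply: (@cvgC_sub _ phi k) => //; exact: qf_cvg.
have H1 : (fun N => qf q N * cc q N (b * n)) @ \oo --> (qpoch_inf q q)^-1.
  have S1 := sub q _ _ q1 (leq_subD (b * n)).
  have S2 := sub q _ _ q1 (leq_addD0 (b * n)).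
  have := cvgCM (qf_cvg q1) (cvgCM S1 S2); rewrite mulrA (mulfV Q0) mul1r.
  by apply: (@cvgC_near _ (b * n)) => N bN; rewrite /cc bN invfM.
have H2 : (fun N => qb p (2 * N) (N - n)) @ \oo --> (qpoch_inf p p)^-1.
  have S0 : (fun N => qf p (2 * N)) @ \oo --> qpoch_inf p p.
    by apply: (@cvgC_sub _ (fun N => (2 * N)%N) 0%N); [move=> m; lia | exact: qf_cvg].
  have S1 := sub p _ _ p1 (leq_subD n).
  have S2 := sub p _ _ p1 (leq_addD0 n).
  have := cvgCM S0 (cvgCM S1 S2); rewrite mulrA (mulfV P0) mul1r.
  apply: (@cvgC_near _ n) => N nN; rewrite (@qbE _ _ _ (N - n) (N + n)) ?invfM //.
  by lia.
have H3 := cvgCM (@cvgC_cst R (- L)) H2.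
have := cvgCM (@cvgC_cst R (wt q c n)) (cvgCD H1 H3).
have -> : wt q c n * ((qpoch_inf q q)^-1 + - L / qpoch_inf p p) = 0.
  by rewrite /L mulNr mulrAC (mulfV P0) mul1r subrr mulr0.
by apply: (@cvgC_near _ 0) => N _; rewrite /g; ring.
Qed.

End Limit.

(** * Absolute convergence and the theorem *)

Lemma sumn_take_lt (k N : nat) (s : seq nat) : s != [::] ->
  all (fun x => x < N)%N s -> (sumn (take k.+1 s) < k.+1 * N)%N.
Proof.
elim: k s => [|k IH] [|x [|y s]] _ // /andP[xN sN].
- by rewrite /= addn0 mul1n.
- by rewrite /= addn0 mul1n.
- by rewrite /= addn0 (leq_trans xN) // leq_pmull.
have h := IH (y :: s) isT sN.
by rewrite mulSn; apply: (leq_add xN (ltnW h)).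
Qed.

Section BoxSums.
Local Open Scope classical_set_scope.
Variable R : realType.
Local Notation C := R[i].

Lemma cvgC_bounded (u : nat -> C) (a : C) : u @ \oo --> a -> exists K, forall n, `|u n| <= K.
Proof.
move=> /cvgCP /(_ 1 ltr01) [N HN]; exists (\sum_(i < N) `|u i| + (`|a| + 1)) => n.
have [nN|Nn] := ltnP n N.
  rewrite (bigD1 (Ordinal nN)) //= -addrA lerDl; apply: addr_ge0; first exact: sumr_ge0.
  exact: addr_ge0.
apply: (@le_trans _ _ (`|a| + 1)); last by rewrite lerDr sumr_ge0.
rewrite -[u n](subKr a); apply: le_trans (ler_normB _ _) _.
by rewrite lerD2l ltW // HN.
Qed.

Lemma cvgC_squeeze0 (u v : nat -> C) :
  (forall n, `|u n| <= v n) -> v @ \oo --> (0 : C) -> u @ \oo --> (0 : C).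
Proof.
move=> uv /cvgCP v0; apply/cvgCP => eps e0; have [N HN] := v0 eps e0.
exists N => n Nn; rewrite sub0r normrN; apply: le_lt_trans (uv n) _.
have := HN n Nn; rewrite sub0r normrN ger0_norm //.
by apply: le_trans (uv n).
Qed.

(** In the box of side N the weight adds at most e + 1 entries, each below N. *)
Lemma ler_box_weight (d e N : nat) (f : seq nat -> C) : (0 < d)%N -> (forall s, 0 <= f s) ->
  \sum_(s <- box d N) f s <=
  \sum_(s <- box d (e.+1 * N) | (sumn (take e.+1 s) < e.+1 * N)%N) f s.
Proof.
move=> d0 f0; rewrite (@box_restrict _ d N (e.+1 * N)) ?leq_pmull //.
rewrite [leLHS]big_mkcond [leRHS]big_mkcond !big_seq; apply: ler_sum => s sbox.
case: ifP => [/= sN|_]; last by case: ifP.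
rewrite sumn_take_lt //; apply: contraTneq d0 => s0.
by rewrite -(size_box sbox) s0.
Qed.

(** The tuples of the box with weight at least N contribute at most G((e+1)N) - G(N), where G sums
    the majorant g by weight; this tends to 0 because G converges. *)
Lemma sums_Zd_weight (d e : nat) (f g : seq nat -> C) (L L' : C) : (0 < d)%N ->
  (forall s, `|f s| <= g s) ->
  (fun N => \sum_(s <- box d N | (sumn (take e.+1 s) < N)%N) f s) @ \oo --> L ->
  (fun N => \sum_(s <- box d N | (sumn (take e.+1 s) < N)%N) g s) @ \oo --> L' ->
  sums_Zd d f L.
Proof.
move=> d0 fg fL gL; have g0 s : 0 <= g s by apply: le_trans (fg s).
pose G N := \sum_(s <- box d N | (sumn (take e.+1 s) < N)%N) g s.
have G0 N : 0 <= G N by apply: sumr_ge0.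
split.
  have [K HK] := cvgC_bounded gL; exists K => N.
  apply: le_trans (HK (e.+1 * N)%N); rewrite ger0_norm; last exact: G0.
  apply: le_trans (ler_box_weight e N d0 g0).
  by apply: ler_sum => s _.
pose D N := \sum_(s <- box d N | ~~ (sumn (take e.+1 s) < N)%N) f s.
have D0 : D @ \oo --> (0 : C).
  apply: (@cvgC_squeeze0 _ (fun n => G (e.+1 * n)%N + - 1 * G n)) => [n|].
    rewrite mulN1r lerBrDr; apply: le_trans (ler_box_weight e n d0 g0).
    rewrite [leRHS](bigID (fun s => sumn (take e.+1 s) < n)%N) /= [leLHS]addrC; apply: lerD; first exact: lexx.
    by apply: le_trans (ler_norm_sum _ _ _) _; apply: ler_sum => s _.
  have sub : (G \o (fun N => (e.+1 * N)%N)) @ \oo --> L'.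
    apply: (@cvgC_sub _ _ 0%N) gL => n; rewrite addn0; exact: leq_pmull.
  have := cvgCD sub (cvgCM (@cvgC_cst R (- 1)) gL).
  by rewrite mulN1r subrr.
have H := cvgCD fL D0; rewrite addr0 in H; apply: (@cvgC_near _ 0 _ _ _ _ H) => N _.
by rewrite [RHS](bigID (fun s => sumn (take e.+1 s) < N)%N).
Qed.

Lemma chain_headE (q : C) (bs : seq bool) (m : nat) : `|q| < 1 -> bs != [::] ->
  chain_head q bs m =
  bailey_sum q ((burge_pair bs).1 * (burge_pair bs).2) (burge_pair bs).1 m.
Proof.
move=> q1; case: bs => // t ts _; have := chain_first (qf_neq0_lt1 q1) t ts m.
by rewrite [chain_head _ _ _]/=; case: (burge_pair (t :: ts)).
Qed.

Lemma cvg_full_term (q : C) (a b e : nat) (bs : seq bool) : `|q| < 1 -> bs != [::] ->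
  (1 < b)%N -> (e.+1 * b < a)%N -> burge_pair bs = (b, a - e.+1 * b)%N ->
  (fun N => \sum_(s <- box (e + (size bs).+1) N | (sumn (take e.+1 s) < N)%N)
     full_term q e bs s) @ \oo --> rhs q a b.
Proof.
(* c is the coefficient after the chain, which gives b(a - (e+1)b), and e Bailey steps. It is ab -
   b^2, and b >= 2 makes it at least 2, as the domination requires. *)
move=> q1 bs0 b1 eba bsE; pose c := (b * (a - e.+1 * b) + e * b ^ 2)%N.
have cE : (c + b ^ 2 = a * b)%N.
  rewrite /c -addnA -mulSnr -mulnn mulnA -[X in (_ + X)%N]mulnC -mulnDr subnK ?(ltnW eba) //.
  by rewrite mulnC.
have c1 : (1 < c)%N.
  by rewrite /c (leq_trans b1) // (leq_trans _ (leq_addr _ _)) // leq_pmulr // subn_gt0.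
pose X N := \sum_(m < N) q ^+ (m ^ 2) * bailey_sum q c b m.
apply: (@cvgC_near _ 0 X) => [N _|].
  rewrite sum_full_term_lt //; apply: eq_bigr => m _; congr (_ * _).
  rewrite (@bailey_sum_iter _ _ (qf_neq0_lt1 q1) e (b * (a - e.+1 * b)) b) //.
  - by rewrite muln_gt0 subn_gt0 eba ltnW.
  - exact: ltnW.
  by move=> m'; rewrite chain_headE // bsE.
have c2 : (1 < c + b ^ 2)%N by apply: ltn_addr.
have H := cvgCD (cvg_bailey_sum q1 c1 (ltnW b1)) (cvg_theta b q1 c2).
have {}H : (fun N => X N.+1) @ \oo --> rhs q a b.
  move: H; rewrite add0r cE /rhs -mulnA; apply: (@cvgC_near _ 0) => N _.
  by rewrite /X subrK.
apply: (@cvgC_near _ 1 ((fun N => X N.+1) \o predn)).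
  by move=> [|N].
by apply: (@cvgC_sub _ _ 1%N) H => n; rewrite addn1 leqSpred.
Qed.

Lemma sums_off_term (q : C) (a b e : nat) (l : seq nat) : `|q| < 1 -> l != [::] ->
  (1 < b)%N -> (e.+1 < cf_d l)%N -> (e.+1 * b < a)%N ->
  burge_pair (step_types l e.+1) = (b, a - e.+1 * b)%N ->
  sums_Zd (cf_d l) (fun s => off_term q l e (vec s) (vec s)) (rhs q a b).
Proof.
move=> q1 l0 b1 ed eba bsE; pose bs := step_types l e.+1.
have sbs : (e + (size bs).+1 = cf_d l)%N by rewrite /bs size_map size_iota; lia.
have bs0 : bs != [::] by rewrite -size_eq0 /bs size_map size_iota -lt0n; lia.
have q1' : `| `|q| | < 1 by rewrite normr_id.
suff [[K HK] H] : sums_Zd (cf_d l) (full_term q e bs) (rhs q a b).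
  have E N : {in box (cf_d l) N, forall s, off_term q l e (vec s) (vec s) = full_term q e bs s}.
    by move=> s sbox; apply: off_term_full => //; [exact: in_T_cf_d | exact: size_box sbox].
  split.
    exists K => N; rewrite big_seq (eq_bigr (fun s => `|full_term q e bs s|)) -?big_seq //.
    by move=> s sbox; rewrite (E N).
  apply: (@cvgC_near _ 0) H => N _; rewrite [LHS]big_seq [RHS]big_seq.
  by apply: eq_bigr => s sbox; rewrite (E N).
apply: (@sums_Zd_weight _ e _ (full_term `|q| e bs) _ (rhs `|q| a b)).
- by lia.
- exact: norm_full_term.
- by rewrite -sbs; apply: cvg_full_term.
- by rewrite -sbs; apply: cvg_full_term.
Qed.

End BoxSums.

Lemma off_term0 (R : realType) (q : R[i]) (l : seq nat) (n m : nat -> nat) :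
  off_term q l 0 n m = term1 q l m.
Proof. by rewrite /off_term [\sum_(1 <= i < 1) _]big_geq // [\prod_(1 <= i < 1) _]big_geq // add0r mul1r. Qed.

Unset Implicit Arguments.
Set Strict Implicit.
Set Printing Implicit Defensive.

Theorem theorem3p11 (R : realType) (q : R[i]) (a b : nat) (l : seq nat) :
  `|q| < 1 ->
  coprime a b -> (1 <= b)%N -> (b < a)%N ->
  is_cf_expansion a b l ->
  ((a < 2 * b)%N ->
     sums_Zd (cf_d l) (fun s => term1 q l (vec s)) (rhs q a b))
  /\
  ((2 * b < a)%N -> b != 1%N ->
     sums_Zd (cf_d l) (fun s => term2 q l (vec s) (vec s)) (rhs q a b)).
Proof.
move=> q1 ab b0 ba lcf; have [l0 _ llast _] := lcf.
split=> [a2b | a2b bn1].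
  rewrite (_ : (fun s => _) = (fun s => off_term q l 0 (vec s) (vec s))); last first.
    by apply/funext => s; rewrite off_term0.
  have d1 : (1 < cf_d l)%N by apply: leq_trans llast (last_le_cf_d l).
  apply: sums_off_term => //; try (rewrite ?mul1n; lia).
  by rewrite mul1n; apply: cf_burge_pair_lt.
have b1 : (1 < b)%N by rewrite ltn_neqAle eq_sym bn1.
have [ed eba bsE] := cf_burge_pair_gt ab b1 a2b lcf.
(* [term2] is [off_term] with e = a_0 up to conversion. *)
by apply: (@sums_off_term _ _ a b (cf_a0 l)).
Qed.
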